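(* Let $E$ be a real Banach lattice with order continuous norm. Let $\mathscr{T} = (T(t))_{t\in[0,\infty)}$ be a positive, bounded, irreducible and strongly continuous semigroup on $E$ such that $\mathrm{Fix}(\mathscr{T}) \neq \{0\}$. If $T(t_0)$ is a Harris operator for some $t_0>0$, then there exist a strictly positive $x' \in \mathrm{Fix}(\mathscr{T}')$ and a quasi-interior point $e$ of $E_+$ with $e \in \mathrm{Fix}(\mathscr{T})$ such that \[ \lim_{t\to\infty} T(t)x = \langle x',x\rangle\, e \quad \text{for all } x\in E.\]
   Context: Let $E$ be a real Banach lattice with order continuous norm, $E_+$ its positive cone, and $\mathbb{N}=\{1,2,\dots\}$. An element $y\in E_+$ is a quasi-interior point of $E_+$ if the principal ideal $E_y=\{x\in E: |x|\le cy \text{ for some } c>0\}$ is dense in $E$. A positive functional $x'\in E'$ is strictly positive if $\langle x',|x|\rangle>0$ for all $x\ne0$. A strongly continuous semigroup is a family $\mathscr{T}=(T(t))_{t\in[0,\infty)}$ of bounded linear operators on $E$ with $T(0)=I$, $T(t+s)=T(t)T(s)$ for all $t,s\geq 0$, and $t\mapsto T(t)x$ continuous for every $x\in E$. It is positive if every $T(t)$ is positive, and bounded if $\sup_t\|T(t)\|<\infty$. It is irreducible if the only closed (lattice) ideals $J\subseteq E$ with $T(t)J\subseteq J$ for all $t$ are $\{0\}$ and $E$. $\mathrm{Fix}(\mathscr{T})=\bigcap_t\ker(I-T(t))$, and $\mathrm{Fix}(\mathscr{T}')=\bigcap_t\ker(I-T(t)')\subseteq E'$, where $T(t)'$ is the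 adjoint of $T(t)$. A linear operator on $E$ is regular if it is the difference of two positive operators; the regular operators on $E$ form an order complete vector lattice. $E'\otimes E$ denotes the space of finite rank operators on $E$, and $(E'\otimes E)^{\perp}$ its disjoint complement in the lattice of regular operators. A regular operator $T$ is a Harris operator if $T^n\notin (E'\otimes E)^{\perp}$ for some $n\in\mathbb{N}$. *)

(* Defs.v *)
From HB Require Import structures.
From mathcomp Require Import all_boot all_order all_algebra.
From mathcomp Require Import all_classical all_reals all_analysis.
Set Implicit Arguments.
Unset Strict Implicit.
Unset Printing Implicit Defensive.
Import Order.TTheory GRing.Theory Num.Theory.
Import numFieldNormedType.Exports.
Local Open Scope classical_set_scope.
Local Open Scope ring_scope.

Reserved Notation "x <=L y" (at level 70, y at next level).

(* The order of a Banach lattice is a relation of its own rather than an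
   instance of [latticeType]: in the library's hierarchy a type that carries
   both an order and a norm is forced to be a [numDomainType].
   The bars [`|x|] denote the norm, as always in the library; the lattice
   absolute value is the join of [x] and [- x], named [labs] below. *)
HB.mixin Record isBanachLattice (R : realType) E of CompleteNormedModule R E := {
  vle : rel E ;
  vjoin : E -> E -> E ;
  vmeet : E -> E -> E ;
  vle_refl : reflexive vle ;
  vle_anti : antisymmetric vle ;
  vle_trans : transitive vle ;
  vle_join : forall x y z : E, vle (vjoin x y) z = vle x z && vle y z ;
  vle_meet : forall x y z : E, vle z (vmeet x y) = vle z x && vle z y ;
  vle_add2r : forall x y z : E, vle x y -> vle (x + z) (y + z) ;
  vle_scale_ge0 : forall (a : R) (x : E), 0 <= a -> vle 0 x -> vle 0 (a *: x) ;
  vle_norm : forall x y : E,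
    vle (vjoin x (- x)) (vjoin y (- y)) -> `|x| <= `|y|
}.

#[short(type="banachLatticeType")]
HB.structure Definition BanachLattice (R : realType) :=
  { E of CompleteNormedModule R E & isBanachLattice R E }.

Notation "x <=L y" := (vle x y) : ring_scope.

Definition labs {R : realType} {E : banachLatticeType R} (x : E) : E :=
  vjoin x (- x).

Section BanachLatticeTheory.
Context {R : realType} {E : banachLatticeType R}.

Definition down_directed (A : set E) : Prop :=
  forall x y, A x -> A y -> exists2 z, A z & z <=L x /\ z <=L y.

Definition is_inf (A : set E) (b : E) : Prop :=
  (forall x, A x -> b <=L x) /\
  (forall c, (forall x, A x -> c <=L x) -> c <=L b).

Definition is_ideal (J : set E) : Prop :=
  [/\ J 0,
      forall (a : R) (x y : E), J x -> J y -> J (a *: x + y) &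
      forall x y : E, J x -> labs y <=L labs x -> J y].

Definition principal_ideal (y : E) : set E :=
  [set x | exists2 c : R, 0 < c & labs x <=L c *: y].

Definition quasi_interior (y : E) : Prop :=
  0 <=L y /\ dense (principal_ideal y).

Definition positive_functional (f : E -> R) : Prop :=
  forall x, 0 <=L x -> 0 <= f x.

Definition strictly_positive (f : E -> R) : Prop :=
  positive_functional f /\ forall x, x != 0 -> 0 < f (labs x).

Definition positive_operator (S : E -> E) : Prop :=
  forall x, 0 <=L x -> 0 <=L S x.

Definition bounded_operator (S : E -> E) : Prop :=
  exists M : R, forall x, `|S x| <= M * `|x|.

(* An operator is a map [E -> E], so that [0] and [-] are the pointwise ones;
   linearity comes with the definitions of [regular_operator] and
   [finite_rank]. *)
Definition regular_operator (S : E -> E) : Prop :=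
  exists P Q : {linear E -> E},
    [/\ positive_operator P, positive_operator Q & S = (P : E -> E) \- Q].

Definition op_le (S T : E -> E) : Prop :=
  forall x, 0 <=L x -> S x <=L T x.

Definition is_op_sup (S T U : E -> E) : Prop :=
  [/\ regular_operator U, op_le S U, op_le T U &
      forall V, regular_operator V -> op_le S V -> op_le T V -> op_le U V].

Definition is_op_inf (S T U : E -> E) : Prop :=
  [/\ regular_operator U, op_le U S, op_le U T &
      forall V, regular_operator V -> op_le V S -> op_le V T -> op_le V U].

(* |S| /\ |T| = 0.  Suprema and infima are relations because the regular
   operators form a lattice only under additional assumptions on [E], such as
   order completeness, under which the two moduli always exist. *)
Definition op_disjoint (S T : E -> E) : Prop :=
  exists absS absT : E -> E,
    [/\ is_op_sup S (- S) absS, is_op_sup T (- T) absT & is_op_inf absS absT 0].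

Definition op_disjoint_complement (A : set (E -> E)) : set (E -> E) :=
  [set S | regular_operator S /\ forall K, A K -> op_disjoint S K].

(* E' (x) E *)
Definition finite_rank : set (E -> E) :=
  [set K | exists (n : nat) (f : 'I_n -> {scalar E}) (y : 'I_n -> E),
     (forall i, continuous (f i)) /\ K = fun x => \sum_(i < n) f i x *: y i].

Definition harris (S : E -> E) : Prop :=
  regular_operator S /\
  exists2 n : nat, (0 < n)%N & ~ op_disjoint_complement finite_rank (iter n S).

(* A semigroup is indexed by all of [R], but only its values at nonnegative
   times are ever used. *)
Definition strongly_continuous_semigroup (T : R -> {linear E -> E}) : Prop :=
  [/\ forall t, 0 <= t -> bounded_operator (T t),
      forall x, T 0 x = x,
      forall t s, 0 <= t -> 0 <= s -> forall x, T (t + s) x = T t (T s x) &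
      forall x, {within `[0, +oo[, continuous (fun t => T t x)}].

Definition positive_semigroup (T : R -> {linear E -> E}) : Prop :=
  forall t, 0 <= t -> positive_operator (T t).

Definition bounded_semigroup (T : R -> {linear E -> E}) : Prop :=
  exists M : R, forall t, 0 <= t -> forall x, `|T t x| <= M * `|x|.

Definition irreducible_semigroup (T : R -> {linear E -> E}) : Prop :=
  forall J : set E, is_ideal J -> closed J ->
    (forall t, 0 <= t -> T t @` J `<=` J) -> J = [set 0] \/ J = setT.

Definition Fix (T : R -> {linear E -> E}) : set E :=
  [set x | forall t, 0 <= t -> T t x = x].

Definition adjoint (S : E -> E) (f : E -> R) : E -> R := f \o S.

Definition Fix_adjoint (T : R -> {linear E -> E}) : set {scalar E} :=
  [set f | continuous f /\ forall t, 0 <= t -> adjoint (T t) f = f].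

End BanachLatticeTheory.

(* Nets decreasing to [0] are rendered by nonempty downward directed sets with
   infimum [0]. *)
Definition order_continuous_norm (R : realType) (E : banachLatticeType R) : Prop :=
  forall A : set E, A !=set0 -> down_directed A -> is_inf A 0 ->
    inf [set `|x| | x in A] = 0.

(* Main.v *)
Require Import Defs.
From HB Require Import structures.
From mathcomp Require Import all_boot all_order all_algebra.
From mathcomp Require Import all_classical all_reals all_analysis.
From mathcomp Require Import ring lra.
Import Order.TTheory GRing.Theory Num.Theory.
Import numFieldNormedType.Exports.
Local Open Scope classical_set_scope.
Local Open Scope ring_scope.
Set Implicit Arguments.
Unset Strict Implicit.
Unset Printing Implicit Defensive.

(** Irreducibility and a nonzero fixed vector provide a strictly positive
    functional [phi] that is constant along orbits, and a fixed vector [h >= 0]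
    with [phi h = 1] ([markov_pair]); the fixed vectors are the multiples of [h]
    ([fixed_multiple]).  Since [h] is quasi-interior and the semigroup is
    bounded, it suffices to show that [T t x] tends to [phi x *: h] when
    [|x| <= h].

    By the Harris hypothesis, some [T t1] dominates a nonzero positive operator
    [U] that is also dominated by an operator of rank one:
    [U x <= psi x *: y] for [x >= 0] ([not_disjoint_finite_rank]).  Such an
    operator maps order intervals to relatively compact sets
    ([rank_one_dominated_approx]).  The proof is the one for Hilbert-Schmidt
    operators, carried out for the quadratic form [psi (x ^ 2)]; the square is
    defined by the lattice operations alone, as the supremum of the tangents
    [2 l x - l ^ 2 z], where the vector [z] stands for the constant function
    [1].  Now choose [b] such that [U2 = U T(b) U] is not zero.  The positive
    [x] with [psi x <= 1] have their images [U2 x] in a relatively compact set,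
    on which [T s] tends to the identity uniformly as [s] tends to [0].  Hence
    [U2] and [T s U2] are not disjoint for small [s], which yields a nonzero
    [Q >= 0] dominated by [T c] and by [T (c + s)] ([overlap]).

    Put [W = (I + T s) / 2], so that [T (c + s) >= Q W].  By irreducibility,
    what remains when all such terms are split off is negligible: for every
    [k] there are [t] and positive operators with [T t = Q' W ^ k + S] and
    [S h] as small as desired ([small_remainder], [decomposition_small]).  On
    [[- h, h]] the operators [W ^ k (I - T s)] tend to [0], as binomial
    distributions flatten ([binomial_mean_difference]).  Therefore
    [T t (x - T s x)] tends to [0] ([difference_vanishes]).

    It remains to identify the limit, as in von Neumann's mean ergodic
    theorem: among the [c] in [[- h, h]] with [T t (x - c)] tending to [0], those
    that almost minimize [phi (c ^ 2)] converge to a fixed vector, because no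
    [T s] increases this quantity ([convergence_interval]).

    Order continuity of the norm enters through the existence of suprema and
    their approximation in norm by finite joins ([lub_approx]), and through the
    convergence of decreasing sequences ([decreasing_limit]). *)

(** * Vector lattices *)

Section VectorLattice.
Context {R : realType} {E : banachLatticeType R}.
Implicit Types (x y z t : E) (a b c : R).

Definition vpos x : E := vjoin x 0.

Lemma vlexx x : x <=L x. Proof. exact: vle_refl. Qed.

Lemma le_vle_trans y x z : x <=L y -> y <=L z -> x <=L z.
Proof. exact: vle_trans. Qed.

Lemma vle_eq x y : x <=L y -> y <=L x -> x = y.
Proof. by move=> h1 h2; apply: vle_anti; rewrite h1. Qed.

Lemma vleD2r z x y : (x + z <=L y + z) = (x <=L y).
Proof.
apply/idP/idP => [/(@vle_add2r _ _ _ _ (- z))|]; first by rewrite !addrK.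
exact: vle_add2r.
Qed.

Lemma vleD2l z x y : (z + x <=L z + y) = (x <=L y).
Proof. by rewrite ![z + _]addrC vleD2r. Qed.

Lemma vleD x y z t : x <=L y -> z <=L t -> x + z <=L y + t.
Proof.
by move=> xy zt; apply: (@le_vle_trans (y + z)); rewrite ?vleD2r ?vleD2l.
Qed.

Lemma vle_subr_addr x y z : (x <=L y - z) = (x + z <=L y).
Proof. by rewrite -(vleD2r z) subrK. Qed.

Lemma vle_subl_addr x y z : (x - y <=L z) = (x <=L z + y).
Proof. by rewrite -(vleD2r y) subrK. Qed.

Lemma vsubr_ge0 x y : (0 <=L y - x) = (x <=L y).
Proof. by rewrite vle_subr_addr add0r. Qed.

Lemma vleN2 x y : (- x <=L - y) = (y <=L x).
Proof. by rewrite -vsubr_ge0 opprK addrC vsubr_ge0. Qed.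

Lemma vleN0 x : (- x <=L 0) = (0 <=L x).
Proof. by rewrite -[X in _ <=L X]oppr0 vleN2. Qed.

Lemma vaddr_ge0 x y : 0 <=L x -> 0 <=L y -> 0 <=L x + y.
Proof. by move=> hx hy; rewrite -[0]addr0; exact: vleD. Qed.

Lemma vleDl x y : 0 <=L y -> x <=L x + y.
Proof. by move=> hy; rewrite -[X in X <=L _]addr0 vleD2l. Qed.

Lemma vleDr x y : 0 <=L y -> x <=L y + x.
Proof. by rewrite addrC; exact: vleDl. Qed.

Lemma vscale_ge0 a x : 0 <= a -> 0 <=L x -> 0 <=L a *: x.
Proof. exact: vle_scale_ge0. Qed.

Lemma vle_scale a x y : 0 <= a -> x <=L y -> a *: x <=L a *: y.
Proof.
by move=> a0 xy; rewrite -vsubr_ge0 -scalerBr vscale_ge0 ?vsubr_ge0.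
Qed.

Lemma vle_scale2r a b x : 0 <=L x -> a <= b -> a *: x <=L b *: x.
Proof.
by move=> x0 ab; rewrite -vsubr_ge0 -scalerBl vscale_ge0 ?subr_ge0.
Qed.

Lemma vle_scale2l a x y : 0 < a -> (a *: x <=L a *: y) = (x <=L y).
Proof.
move=> a0; apply/idP/idP; last by apply: vle_scale; exact: ltW.
move=> h; have /vle_scale /(_ h) : 0 <= a^-1 by rewrite invr_ge0 ltW.
by rewrite !scalerA mulVf ?gt_eqF // !scale1r.
Qed.

Lemma vsumr_ge0 (I : Type) (r : seq I) (P : pred I) (F : I -> E) :
  (forall i, P i -> 0 <=L F i) -> 0 <=L \sum_(i <- r | P i) F i.
Proof.
by move=> h; elim/big_ind: _ => //; [exact: vlexx | exact: vaddr_ge0].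
Qed.

Lemma vle_sum (I : Type) (r : seq I) (P : pred I) (F G : I -> E) :
  (forall i, P i -> F i <=L G i) ->
  \sum_(i <- r | P i) F i <=L \sum_(i <- r | P i) G i.
Proof.
move=> h; rewrite -vsubr_ge0 -sumrB; apply: vsumr_ge0 => i Pi.
by rewrite vsubr_ge0 h.
Qed.

Lemma vjoin_le x y z : (vjoin x y <=L z) = (x <=L z) && (y <=L z).
Proof. exact: vle_join. Qed.

Lemma vle_joinl x y : x <=L vjoin x y.
Proof. by have := vlexx (vjoin x y); rewrite vjoin_le => /andP[]. Qed.

Lemma vle_joinr x y : y <=L vjoin x y.
Proof. by have := vlexx (vjoin x y); rewrite vjoin_le => /andP[]. Qed.

Lemma vjoin_lub x y z : x <=L z -> y <=L z -> vjoin x y <=L z.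
Proof. by rewrite vjoin_le => -> ->. Qed.

Lemma vle_meetE x y z : (z <=L vmeet x y) = (z <=L x) && (z <=L y).
Proof. exact: vle_meet. Qed.

Lemma vmeet_lel x y : vmeet x y <=L x.
Proof. by have := vlexx (vmeet x y); rewrite vle_meetE => /andP[]. Qed.

Lemma vmeet_ler x y : vmeet x y <=L y.
Proof. by have := vlexx (vmeet x y); rewrite vle_meetE => /andP[]. Qed.

Lemma vmeet_glb x y z : z <=L x -> z <=L y -> z <=L vmeet x y.
Proof. by rewrite vle_meetE => -> ->. Qed.

Lemma vjoinC x y : vjoin x y = vjoin y x.
Proof. by apply: vle_eq; rewrite vjoin_le vle_joinl vle_joinr. Qed.

Lemma vjoinDr x y z : vjoin (x + z) (y + z) = vjoin x y + z.
Proof.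
apply: vle_eq.
  by rewrite vjoin_le !vleD2r vle_joinl vle_joinr.
rewrite -(vleD2r (- z)) addrK vjoin_le.
by rewrite !vle_subr_addr vle_joinl vle_joinr.
Qed.

Lemma vjoinZ a x y : 0 < a -> vjoin (a *: x) (a *: y) = a *: vjoin x y.
Proof.
move=> a0; apply: vle_eq.
  by rewrite vjoin_le !vle_scale2l // vle_joinl vle_joinr.
have aV : a * a^-1 = 1 by rewrite mulfV // gt_eqF.
rewrite -[X in _ <=L X]scale1r -aV -scalerA vle_scale2l //.
rewrite vjoin_le -(vle_scale2l x _ a0) -(vle_scale2l y _ a0) !scalerA aV !scale1r.
by rewrite vle_joinl vle_joinr.
Qed.

Lemma vpos_ge0 x : 0 <=L vpos x. Proof. exact: vle_joinr. Qed.
Lemma vle_vpos x : x <=L vpos x. Proof. exact: vle_joinl. Qed.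

Lemma vpos_id x : 0 <=L x -> vpos x = x.
Proof. by move=> x0; apply: vle_eq; rewrite ?vjoin_le ?vlexx //= vle_vpos. Qed.

Lemma vpos0 x : x <=L 0 -> vpos x = 0.
Proof. by move=> x0; apply: vle_eq; rewrite ?vjoin_le ?vlexx ?vpos_ge0 ?x0. Qed.

Lemma vposN x : vpos (- x) = vpos x - x.
Proof. by rewrite /vpos -vjoinDr subrr add0r vjoinC. Qed.

Lemma vposB x : vpos x - vpos (- x) = x.
Proof. by rewrite vposN opprB addrC subrK. Qed.

Lemma vposZ a x : 0 < a -> vpos (a *: x) = a *: vpos x.
Proof. by move=> a0; rewrite /vpos -vjoinZ // scaler0. Qed.

Lemma labsE x : labs x = vpos x + vpos (- x).
Proof.
have -> : labs x = vpos ((1 + 1) *: x) - x.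
  rewrite /vpos -vjoinDr scalerDl scale1r addrK add0r //.
by rewrite vposZ ?ltr0n // vposN scalerDl scale1r addrA.
Qed.

Lemma vle_labs x : x <=L labs x. Proof. exact: vle_joinl. Qed.
Lemma vleN_labs x : - x <=L labs x. Proof. exact: vle_joinr. Qed.

Lemma labs_ge0 x : 0 <=L labs x.
Proof. by rewrite labsE vaddr_ge0 ?vpos_ge0. Qed.

Lemma labs_le x y : (labs x <=L y) = (x <=L y) && (- x <=L y).
Proof. exact: vjoin_le. Qed.

Lemma labsN x : labs (- x) = labs x.
Proof. by rewrite /labs opprK vjoinC. Qed.

Lemma labs_id x : 0 <=L x -> labs x = x.
Proof.
move=> x0; apply: vle_eq; rewrite ?vle_labs // labs_le vlexx /=.
by apply: (@le_vle_trans 0); rewrite ?vleN0.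
Qed.

Lemma labs0 : labs (0 : E) = 0. Proof. by rewrite labs_id ?vlexx. Qed.

Lemma labsD x y : labs (x + y) <=L labs x + labs y.
Proof.
by rewrite labs_le opprD !vleD ?vle_labs ?vleN_labs.
Qed.

Lemma labsB x y : labs (x - y) <=L labs x + labs y.
Proof. by rewrite -[labs y]labsN; exact: labsD. Qed.

Lemma labs_subC x y : labs (x - y) = labs (y - x).
Proof. by rewrite -labsN opprB. Qed.

Lemma labsZ_ge0 a x : 0 <= a -> labs (a *: x) = a *: labs x.
Proof.
rewrite le_eqVlt => /orP[/eqP<-|a0]; first by rewrite !scale0r labs0.
by rewrite /labs -scalerN vjoinZ.
Qed.

Lemma labsZ a x : labs (a *: x) = `|a| *: labs x.
Proof.
have [a0|a0] := leP 0 a; first by rewrite labsZ_ge0 // ger0_norm.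
by rewrite -labsN -scaleNr labsZ_ge0 ?oppr_ge0 ?(ltW a0) // ltr0_norm.
Qed.

Lemma labs_sum (I : Type) (r : seq I) (F : I -> E) :
  labs (\sum_(i <- r) F i) <=L \sum_(i <- r) labs (F i).
Proof.
elim/big_rec2: _ => [|i y1 y2 _ h]; first by rewrite labs0 vlexx.
by apply: (le_vle_trans (labsD _ _)); rewrite vleD2l.
Qed.

Lemma vpos_le_labs x : vpos x <=L labs x.
Proof. by rewrite vjoin_le vle_labs labs_ge0. Qed.

Lemma vpos_lip x y : labs (vpos x - vpos y) <=L labs (x - y).
Proof.
have key u v : vpos u - vpos v <=L labs (u - v).
  rewrite vle_subl_addr vjoin_le; apply/andP; split.
    by rewrite -{1}(subrK v u) vleD ?vle_labs ?vle_vpos.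
  by rewrite vaddr_ge0 ?labs_ge0 ?vpos_ge0.
by rewrite labs_le key opprB labs_subC key.
Qed.

Lemma labs_lip x y : labs (labs x - labs y) <=L labs (x - y).
Proof.
have key (u v : E) : labs u - labs v <=L labs (u - v).
  by rewrite vle_subl_addr -{1}(subrK v u) labsD.
by rewrite labs_le key opprB labs_subC key.
Qed.

Lemma norm_labs x : `|labs x| = `|x|.
Proof.
apply/eqP; rewrite eq_le.
by rewrite !vle_norm // -/(labs _) -/(labs _) (labs_id (labs_ge0 _)) vlexx.
Qed.

Lemma norm_le x y : 0 <=L x -> x <=L y -> `|x| <= `|y|.
Proof.
move=> x0 xy; apply: vle_norm; rewrite -!/(labs _) !labs_id //.
exact: le_vle_trans xy.
Qed.

Lemma norm_labs_le x y : labs x <=L y -> `|x| <= `|y|.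
Proof. by move=> xy; rewrite -norm_labs norm_le ?labs_ge0. Qed.

Lemma norm_vpos x : `|vpos x| <= `|x|.
Proof. by rewrite -[`|x|]norm_labs norm_le ?vpos_ge0 ?vpos_le_labs. Qed.

Lemma norm_labs_lip x y : `|labs x - labs y| <= `|x - y|.
Proof. by rewrite -[leRHS]norm_labs norm_labs_le ?labs_lip. Qed.

Lemma norm_vpos_lip x y : `|vpos x - vpos y| <= `|x - y|.
Proof. by rewrite -[leRHS]norm_labs norm_labs_le ?vpos_lip. Qed.

Lemma labs_eq0 x : labs x = 0 -> x = 0.
Proof. by move=> h; apply/eqP; rewrite -normr_eq0 -norm_labs h normr0. Qed.

(** If [m] is a lower bound of both parts of [x], then [vpos x - m] still
    bounds [x] and [0] from above. *)
Lemma vpos_disj x : vmeet (vpos x) (vpos (- x)) = 0.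
Proof.
apply: vle_eq; last by rewrite vmeet_glb ?vpos_ge0.
set m := vmeet _ _.
have : vpos x <=L vpos x - m.
  rewrite {1}/vpos vjoin_le !vle_subr_addr add0r vmeet_lel andbT.
  by rewrite addrC -vle_subr_addr -vposN vmeet_ler.
by rewrite vle_subr_addr -[X in _ <=L X]addr0 vleD2l.
Qed.

(** The summands are the meet of [z] and [x], written [z - vpos (z - x)], and
    its complement [vpos (z - x)]. *)
Lemma riesz_decomposition x y z : 0 <=L x -> 0 <=L y -> 0 <=L z -> z <=L x + y ->
  exists u v, [/\ z = u + v, 0 <=L u, u <=L x, 0 <=L v & v <=L y].
Proof.
move=> x0 y0 z0 zxy; exists (z - vpos (z - x)), (vpos (z - x)).
split; rewrite ?vpos_ge0 ?subrK //.
- by rewrite vsubr_ge0 vjoin_le z0 vle_subl_addr vleDl.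
- by rewrite vle_subl_addr addrC -vle_subl_addr vle_vpos.
by rewrite vjoin_le y0 vle_subl_addr addrC zxy.
Qed.

Lemma norm_vpos_ge0 x y : 0 <=L y -> `|vpos (- x)| <= `|x - y|.
Proof.
move=> y0; have := norm_vpos_lip (- x) (- y).
by rewrite (vpos0 (x := - y)) ?vleN0 // subr0 -opprD normrN.
Qed.

(** The cone is closed, the map [vpos] being a contraction. *)
Lemma vge0_norm x : (forall e, 0 < e -> exists2 y, 0 <=L y & `|x - y| < e) ->
  0 <=L x.
Proof.
move=> h; have : vpos (- x) = 0.
  apply/eqP; rewrite -normr_le0; apply/ler_addgt0Pr => e e0; rewrite add0r.
  have [y y0 xy] := h _ e0.
  exact: le_trans (norm_vpos_ge0 _ y0) (ltW xy).
by move=> h0; rewrite -vleN0 -h0 vle_vpos.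
Qed.

(** Otherwise the norms of [n%:R *: vpos x], bounded by that of [vpos y], would
    be unbounded. *)
Lemma archimedean_vle0 x y : (forall n : nat, n%:R *: x <=L y) -> x <=L 0.
Proof.
move=> h; suff : vpos x = 0 by move=> h0; rewrite -h0 vle_vpos.
apply/eqP; rewrite -normr_le0 leNgt; apply/negP => c0.
have := h (Num.bound (`|y| / `|vpos x|)).
set n := Num.bound _ => hn.
have n0 : (0 <= n%:R :> R) by [].
have := archi_boundP (divr_ge0 (normr_ge0 y) (normr_ge0 (vpos x))).
rewrite -/n ltr_pdivrMr // ltNge => /negP; apply.
rewrite -[n%:R]ger0_norm // -normrZ.
move: n0; rewrite le_eqVlt => /orP[/eqP<-|n0]; first by rewrite scale0r normr0.
rewrite -vposZ //; apply: le_trans (norm_vpos y).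
by rewrite norm_le ?vpos_ge0 // vjoin_le vpos_ge0 (le_vle_trans hn) ?vle_vpos.
Qed.
End VectorLattice.

(** * Order completeness and the Riesz-Kantorovich theorem *)

Section OrderCompleteness.
Context {R : realType} {E : banachLatticeType R}.
Implicit Types (x y z : E) (A : set E) (e : R).

Definition is_lub A s : Prop :=
  (forall x, A x -> x <=L s) /\ (forall c, (forall x, A x -> x <=L c) -> s <=L c).

Inductive join_closure A : set E :=
| join_closure_in x of A x : join_closure A x
| join_closure_join x y of join_closure A x & join_closure A y :
    join_closure A (vjoin x y).

Lemma cauchy_limit (u : nat -> E) :
  (forall e, 0 < e ->
     exists N, forall n, (N <= n)%N -> `|u N - u n| < e) ->
  exists l, forall e, 0 < e -> exists N, forall n, (N <= n)%N -> `|l - u n| < e.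
Proof.
move=> h; have /cauchy_cvgP /cvg_ex[l /cvgrPdist_lt ul] : cauchy (u @ \oo).
  apply: cauchy_exP => e e0; have [N hN] := h _ e0.
  exists (u N); rewrite -ball_normE; exists N => // n /= Nn; exact: hN.
by exists l => e /ul[N _ hN]; exists N.
Qed.

Lemma inf_norm_lt A : A !=set0 -> inf [set `|x| | x in A] = 0 ->
  forall e, 0 < e -> exists2 x, A x & `|x| < e.
Proof.
move=> [x0 Ax0] h e e0.
have [|_ [x Ax <-]] := @inf_adherent _ [set `|x| | x in A] _ e0.
  split; first by exists `|x0|, x0.
  by exists 0 => _ [x _ <-].
by rewrite h add0r; exists x.
Qed.

Lemma join_closure_le A c : (forall x, A x -> x <=L c) ->
  forall x, join_closure A x -> x <=L c.
Proof. by move=> h x; elim=> [|? ? _ ? _ ?]; [exact: h | exact: vjoin_lub]. Qed.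

Lemma invSn_gt0 n : 0 < n.+1%:R^-1 :> R.
Proof. by rewrite invr_gt0. Qed.

Lemma invSn_lt e : 0 < e -> exists N, forall n, (N <= n)%N -> n.+1%:R^-1 < e.
Proof.
move=> e0; exists (Num.bound e^-1) => n Nn.
rewrite -[ltRHS]invrK ltf_pV2 ?posrE ?invr_gt0 //.
apply: (lt_le_trans (archi_boundP _)); first by rewrite invr_ge0 ltW.
by rewrite ler_nat (leq_trans Nn).
Qed.

(** The differences between upper bounds and finite joins of [A] are directed
    downwards to [0], so order continuity makes some of them small in norm;
    the upper bounds then form a Cauchy sequence whose limit is the
    supremum. *)
Lemma lub_approx A u : order_continuous_norm E -> A !=set0 ->
  (forall x, A x -> x <=L u) ->
  exists s, is_lub A s /\
    forall e, 0 < e -> exists2 a, join_closure A a & `|s - a| < e.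
Proof.
move=> oc [x0 Ax0] Au.
pose ub b := forall x, A x -> x <=L b.
pose D := [set d | exists b a, [/\ ub b, join_closure A a & d = b - a]].
have D0 : D !=set0 by exists (u - x0), u, x0; split => //; exact: join_closure_in.
have Dinf : forall e, 0 < e -> exists2 x, D x & `|x| < e.
  apply: (inf_norm_lt D0); apply: oc => //.
    move=> _ _ [b1 [a1 [ub1 ja1 ->]]] [b2 [a2 [ub2 ja2 ->]]].
    exists (vmeet b1 b2 - vjoin a1 a2).
      exists (vmeet b1 b2), (vjoin a1 a2); split => //.
        by move=> x Ax; rewrite vmeet_glb ?ub1 ?ub2.
      exact: join_closure_join.
    by rewrite !vleD ?vmeet_lel ?vmeet_ler ?vleN2 ?vle_joinl ?vle_joinr.
  split=> [_ [b [a [ubb ja ->]]]|c hc].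
    by rewrite vsubr_ge0; exact: join_closure_le ja.
  have step b : ub b -> ub (b - c).
    move=> ubb x Ax; rewrite vle_subr_addr addrC -vle_subr_addr.
    by apply: hc; exists b, x; split => //; exact: join_closure_in.
  apply: (@archimedean_vle0 _ _ c (u - x0)) => n.
  rewrite vle_subr_addr addrC -vle_subr_addr.
  elim: n x0 Ax0 {D0} => [|n IH] x Ax; first by rewrite scale0r subr0 Au.
  have : ub (u - n%:R *: c) by move=> y; exact: IH.
  move/step => /(_ _ Ax); congr (_ <=L _).
  by rewrite -addn1 natrD scalerDl scale1r opprD addrA.
have /choice[b hb] n : exists b, ub b /\
    exists2 a, join_closure A a & `|b - a| < n.+1%:R^-1.
  have [_ [b [a [ubb ja ->]]] hlt] := Dinf _ (invSn_gt0 n).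
  by exists b; split => //; exists a.
have bd n m : `|b n - b m| < n.+1%:R^-1 + m.+1%:R^-1.
  have [ubn [an jan han]] := hb n; have [ubm [am jam ham]] := hb m.
  apply: le_lt_trans (ltrD han ham).
  have p1 : 0 <=L b n - an by rewrite vsubr_ge0; exact: join_closure_le jan.
  have p2 : 0 <=L b m - am by rewrite vsubr_ge0; exact: join_closure_le jam.
  apply: le_trans (ler_normD _ _); apply: norm_labs_le.
  rewrite labs_le opprB; apply/andP; split.
    apply: le_vle_trans (vleDl _ p2); rewrite vleD2l vleN2.
    exact: join_closure_le jan.
  apply: le_vle_trans (vleDr _ p1); rewrite vleD2l vleN2.
  exact: join_closure_le jam.
have [s hs] : exists s, forall e, 0 < e ->
    exists N, forall n, (N <= n)%N -> `|s - b n| < e.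
  apply: cauchy_limit => e e0.
  have [N hN] := invSn_lt (divr_gt0 e0 (ltr0n R 2)).
  exists N => n Nn; apply: (lt_trans (bd _ _)).
  by rewrite (splitr e) ltrD ?hN.
have near_ub e : 0 < e -> exists b' a', [/\ ub b', join_closure A a',
    `|b' - a'| < e & `|s - b'| < e].
  move=> e0; have [N1 h1] := invSn_lt e0; have [N2 h2] := hs _ e0.
  have [ubn [an jan han]] := hb (maxn N1 N2).
  exists (b (maxn N1 N2)), an; split=> //; last by rewrite h2 ?leq_maxr.
  by apply: (lt_trans han); rewrite h1 ?leq_maxl.
exists s; split; last first.
  move=> e e0; have [b' [a' [_ ja h1 h2]]] := near_ub _ (divr_gt0 e0 (ltr0n R 2)).
  exists a' => //; rewrite (_ : s - a' = (s - b') + (b' - a')); last first.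
    by rewrite addrA subrK.
  by rewrite (splitr e) (le_lt_trans (ler_normD _ _)) ?ltrD.
split=> [x Ax|c hc].
  rewrite -vsubr_ge0; apply: vge0_norm => e /near_ub[b' [a' [ubb _ _ hsb]]].
  exists (b' - x); first by rewrite vsubr_ge0 ubb.
  by rewrite opprB addrA subrK.
rewrite -vsubr_ge0; apply: vge0_norm => e e0.
have [b' [a' [_ ja h1 h2]]] := near_ub _ (divr_gt0 e0 (ltr0n R 2)).
exists (c - a'); first by rewrite vsubr_ge0; exact: join_closure_le ja.
rewrite (_ : c - s - (c - a') = - ((s - b') + (b' - a'))); last first.
  by rewrite addrA subrK !opprB addrC addrA subrK.
by rewrite normrN (splitr e) (le_lt_trans (ler_normD _ _)) ?ltrD.
Qed.

Definition dedekind_complete : Prop := forall A, A !=set0 ->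
  (exists u, forall x, A x -> x <=L u) -> exists s, is_lub A s.

Lemma order_continuous_dedekind : order_continuous_norm E -> dedekind_complete.
Proof.
by move=> oc A A0 [u Au]; have [s [ls _]] := lub_approx oc A0 Au; exists s.
Qed.

Lemma is_lub_unique A s s' : is_lub A s -> is_lub A s' -> s = s'.
Proof. by move=> [h1 h2] [h3 h4]; apply: vle_eq; [exact: h2|exact: h4]. Qed.

(** Order continuity applies to the differences of [d n] and the infimum. *)
Lemma decreasing_limit (d : nat -> E) : order_continuous_norm E ->
  (forall n, 0 <=L d n) -> (forall n, d n.+1 <=L d n) ->
  exists l, [/\ 0 <=L l, forall n, l <=L d n,
    (forall c, (forall n, c <=L d n) -> c <=L l) &
    forall e, 0 < e -> exists N, forall n, (N <= n)%N -> `|d n - l| < e].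
Proof.
move=> oc d0 dS.
have dle n m : (n <= m)%N -> d m <=L d n.
  elim: m => [|m IH]; first by rewrite leqn0 => /eqP->; exact: vlexx.
  rewrite leq_eqVlt ltnS => /orP[/eqP->|/IH]; first exact: vlexx.
  exact: le_vle_trans (dS m).
have [||s [s1 s2]] :=
    @order_continuous_dedekind oc [set - d n | n in [set: nat]].
- by exists (- d 0%N), 0%N.
- by exists 0 => _ [n _ <-]; rewrite vleN0.
have sle n : - s <=L d n by rewrite -vleN2 opprK; apply: s1; exists n.
have sglb c : (forall n, c <=L d n) -> c <=L - s.
  move=> hc; rewrite -vleN2 opprK; apply: s2 => _ [n _ <-].
  by rewrite vleN2.
exists (- s); split=> // [|e e0]; first exact: sglb.
pose A := [set d n - (- s) | n in [set: nat]].
have A0 : A !=set0 by exists (d 0%N - (- s)), 0%N.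
have hA : inf [set `|x| | x in A] = 0.
  apply: oc => //.
    move=> _ _ [n _ <-] [m _ <-]; exists (d (maxn n m) - (- s)).
      by exists (maxn n m).
    by rewrite !vleD2r !dle ?leq_maxl ?leq_maxr.
  split=> [_ [n _ <-]|c hc]; first by rewrite vsubr_ge0.
  have : c + (- s) <=L - s.
    by apply: sglb => n; rewrite -vle_subr_addr; apply: hc; exists n.
  by rewrite -[X in _ <=L X]add0r vleD2r.
have [_ [N _ <-] hN] := inf_norm_lt A0 hA e0.
exists N => n Nn; apply: le_lt_trans hN.
by apply: norm_le; rewrite ?vsubr_ge0 // vleD2r dle.
Qed.

Lemma linear_exists (F : lmodType R) (f : E -> F) : linear f ->
  exists g : {linear E -> F}, (g : E -> F) = f.
Proof.
move=> fl; pose m := GRing.isLinear.Build R E F *:%R f fl.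
by exists (HB.pack_for {linear E -> F} f m).
Qed.

(** Additivity on the cone makes [f u - f v] depend on [u - v] only. *)
Lemma cone_extension (F : lmodType R) (f : E -> F) :
  (forall x y, 0 <=L x -> 0 <=L y -> f (x + y) = f x + f y) ->
  (forall (a : R) x, 0 < a -> 0 <=L x -> f (a *: x) = a *: f x) ->
  exists g : {linear E -> F}, forall x, 0 <=L x -> g x = f x.
Proof.
move=> fD fZ; pose g x := f (vpos x) - f (vpos (- x)).
have f0 : f 0 = 0.
  apply: (@addrI _ (f 0)).
  by rewrite -fD ?vlexx // !addr0.
have gE u v : 0 <=L u -> 0 <=L v -> g (u - v) = f u - f v.
  move=> u0 v0; rewrite /g; set p := vpos _; set n := vpos _.
  apply/eqP; rewrite subr_eq addrAC eq_sym subr_eq; apply/eqP.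
  rewrite -!fD ?vpos_ge0 //; congr f.
  have : p - n = u - v by exact: vposB.
  by move/eqP; rewrite subr_eq addrAC eq_sym subr_eq => /eqP.
have [G GE] : exists G : {linear E -> F}, (G : E -> F) = g.
  apply: linear_exists => a x y.
  have gD u v : g (u + v) = g u + g v.
    rewrite -{1}(vposB u) -{1}(vposB v) addrACA -opprD gE ?vaddr_ge0 ?vpos_ge0 //.
    by rewrite !fD ?vpos_ge0 // opprD addrACA.
  have gN u : g (- u) = - g u by rewrite /g opprK opprB.
  have gZ b u : 0 < b -> g (b *: u) = b *: g u.
    move=> b0; rewrite -{1}(vposB u) scalerBr gE ?vscale_ge0 ?vpos_ge0 ?ltW //.
    by rewrite !fZ ?vpos_ge0 // -scalerBr.
  rewrite gD; congr (_ + _).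
  have [a0|a0|->] := ltgtP a 0; last by rewrite !scale0r /g oppr0 subrr.
    by rewrite -[a]opprK scaleNr gN gZ ?oppr_gt0 // !scaleNr.
  by rewrite gZ.
exists G => x x0; rewrite GE /g vpos_id // [vpos (- x)]vpos0 ?f0 ?subr0 //.
by rewrite vleN0.
Qed.
End OrderCompleteness.

Arguments dedekind_complete {R} E.

Section RieszKantorovich.
Context {R : realType} {E F : banachLatticeType R}.

Definition interval_image (V : E -> F) (x : E) : set F :=
  [set V z | z in [set z | 0 <=L z /\ z <=L x]].

(** Riesz decomposition makes the supremum of [V] over [[0, x]] additive
    in [x], which is why it extends to an operator. *)
Lemma riesz_kantorovich (V : {linear E -> F}) : dedekind_complete F ->
  (forall x, 0 <=L x -> exists b, forall y, interval_image V x y -> y <=L b) ->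
  exists P : {linear E -> F}, forall x, 0 <=L x -> is_lub (interval_image V x) (P x).
Proof.
move=> ded bd.
have /choice[f hf] x : exists s, 0 <=L x -> is_lub (interval_image V x) s.
  have [x0|] := boolP (0 <=L x); last by exists 0.
  have [|s hs] := ded (interval_image V x) _ (bd x x0); last by exists s.
  by exists (V 0), 0; split; rewrite ?vlexx.
have [||P PE] := @cone_extension R E F f; last first.
- by exists P => x x0; rewrite PE //; exact: hf.
- move=> a x a0 x0; apply: (is_lub_unique (hf _ _)); first by rewrite vscale_ge0 ?ltW.
  have [h1 h2] := hf x x0; split=> [_ [z [z0 zx] <-]|c hc].
    rewrite -(vle_scale2l _ _ (a := a^-1)) ?invr_gt0 // scalerA mulVf ?gt_eqF //.
    rewrite scale1r -linearZ; apply: h1; exists (a^-1 *: z) => //; split.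
      by rewrite vscale_ge0 ?invr_ge0 ?ltW.
    rewrite -(vle_scale2l _ _ a0) scalerA mulfV ?gt_eqF // scale1r //.
  rewrite -(vle_scale2l _ _ (a := a^-1)) ?invr_gt0 // scalerA mulVf ?gt_eqF //.
  rewrite scale1r; apply: h2 => _ [z [z0 zx] <-].
  rewrite -(vle_scale2l _ _ a0) scalerA mulfV ?gt_eqF // scale1r -linearZ.
  apply: hc; exists (a *: z) => //; split; first by rewrite vscale_ge0 ?ltW.
  by rewrite vle_scale2l.
- move=> x y x0 y0; apply: (is_lub_unique (hf _ _)); first exact: vaddr_ge0.
  have [h1 h2] := hf x x0; have [h3 h4] := hf y y0.
  split=> [_ [z [z0 zx] <-]|c hc].
    have [u [v [-> u0 ux v0 vy]]] := riesz_decomposition x0 y0 z0 zx.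
    by rewrite linearD vleD ?h1 ?h3 //; [exists u|exists v].
  rewrite -vle_subr_addr; apply: h2 => _ [u [u0 ux] <-].
  rewrite vle_subr_addr addrC -vle_subr_addr; apply: h4 => _ [v [v0 vy] <-].
  rewrite vle_subr_addr addrC -linearD; apply: hc; exists (u + v) => //.
  by split; [exact: vaddr_ge0 | exact: vleD].
Qed.

End RieszKantorovich.

(** * Positive operators and functionals *)

Section PositiveOperators.
Context {R : realType} {E : banachLatticeType R}.
Implicit Types (x y z : E) (S U V P : {linear E -> E}) (f g : {scalar E}).

Lemma positive_mono S : positive_operator S -> forall x y, x <=L y -> S x <=L S y.
Proof. by move=> S0 x y; rewrite -(vsubr_ge0 x) -(vsubr_ge0 (S x)) -linearB; exact: S0. Qed.

Lemma positive_labs S : positive_operator S -> forall x, labs (S x) <=L S (labs x).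
Proof.
move=> S0 x; rewrite labs_le -linearN.
by rewrite !(positive_mono S0) ?vle_labs ?vleN_labs.
Qed.

Lemma positive_comp (S U : E -> E) : positive_operator S -> positive_operator U ->
  positive_operator (S \o U).
Proof. by move=> S0 U0 x /U0 /S0. Qed.

Definition bounded_functional (f : E -> R) : Prop :=
  exists C : R, forall x, `|f x| <= C * `|x|.

Lemma scalarZ f (a : R) x : f (a *: x) = a * f x.
Proof. by rewrite linearZ. Qed.

Lemma functional_mono f : positive_functional f -> forall x y, x <=L y -> f x <= f y.
Proof.
by move=> f0 x y xy; rewrite -subr_ge0 -linearB f0 // vsubr_ge0.
Qed.

Lemma functional_labs f : positive_functional f -> forall x, `|f x| <= f (labs x).
Proof.
move=> f0 x; rewrite ler_norml lerNl -linearN.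
by rewrite !functional_mono ?vle_labs ?vleN_labs.
Qed.

Lemma bounded_functional_pos (f : E -> R) : bounded_functional f ->
  exists2 C : R, 0 < C & forall x, `|f x| <= C * `|x|.
Proof.
move=> [C hC]; exists (`|C| + 1) => [|x]; first by rewrite ltr_wpDl.
apply: le_trans (hC x) _; apply: ler_wpM2r => //.
by rewrite (le_trans (ler_norm C)) // lerDl.
Qed.

Lemma bounded_operator_le S U : positive_operator U -> op_le U S ->
  bounded_operator S -> bounded_operator U.
Proof.
move=> U0 US [M hM]; exists M => x.
rewrite -[`|x|]norm_labs; apply: le_trans (hM _).
apply: norm_labs_le; apply: le_vle_trans (positive_labs U0 x) _.
by apply: US; exact: labs_ge0.
Qed.

Lemma bounded_functional_comp f (S : E -> E) : bounded_functional f ->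
  bounded_operator S -> bounded_functional (f \o S).
Proof.
move=> /bounded_functional_pos[C C0 hC] [M hM]; exists (C * M) => x /=.
by rewrite (le_trans (hC _)) // -mulrA ler_pM2l.
Qed.

Lemma bounded_functional_continuous f : continuous f <-> bounded_functional f.
Proof.
split=> [fc|fb].
  have [g gE] : exists g : {linear E -> R}, (g : E -> R) = f.
    by apply: linear_exists => a x y; rewrite linearP.
  have /linear_boundedP : bounded_near g (nbhs 0).
    by apply: continuous_linear_bounded; rewrite gE; exact: fc.
  move=> [M [_ hM]]; exists (M + 1) => x; rewrite -gE; apply: hM.
  by rewrite ltrDl.
have [C C0 hC] := bounded_functional_pos fb.
move=> x; apply/cvgrPdist_lt => e e0.
near=> y; rewrite -linearB; apply: le_lt_trans (hC _) _.
rewrite mulrC -ltr_pdivlMr //; near: y.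
by apply: cvgr_dist_lt => //; exact: divr_gt0.
Unshelve. all: by end_near. Qed.

Lemma scalar_exists (f : E -> R) : (forall (a : R) x y, f (a *: x + y) = a * f x + f y) ->
  exists g : {scalar E}, (g : E -> R) = f.
Proof.
move=> fl; pose m := GRing.isLinear.Build R E R *%R f fl.
by exists (HB.pack_for {scalar E} f m).
Qed.
End PositiveOperators.

(** * The real line as a Banach lattice *)

Section RealLine.
Context {R : realType}.
Implicit Types (x y z : R^o).

Let rle : rel R^o := fun x y => (x <= y :> R).

Fact real_vle_join x y z : rle (Num.max x y) z = rle x z && rle y z.
Proof. by rewrite /rle ge_max. Qed.

Fact real_vle_meet x y z : rle z (Num.min x y) = rle z x && rle z y.
Proof. by rewrite /rle le_min. Qed.

Fact real_vle_norm x y : rle (Num.max x (- x)) (Num.max y (- y)) -> `|x| <= `|y|.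
Proof.
have maxN (u : R) : Num.max u (- u) = `|u|.
  have [u0|u0] := leP 0 u; first by rewrite ger0_norm // max_l // (le_trans _ u0) // oppr_le0.
  by rewrite ltr0_norm // max_r // (le_trans (ltW u0)) // oppr_ge0 ltW.
by rewrite /rle !maxN.
Qed.

HB.instance Definition _ := isBanachLattice.Build R R^o
  (@lexx _ R) (@le_anti _ R) (@le_trans _ R) real_vle_join real_vle_meet
  (fun x y z (h : x <= y :> R) => etrans (lerD2r z x y) h)
  (fun (a : R) (x : R^o) a0 (x0 : 0 <= x :> R) => mulr_ge0 a0 x0) real_vle_norm.
End RealLine.

(** * Domination by operators of rank one *)

Lemma real_dedekind_complete (R : realType) : dedekind_complete (R^o : banachLatticeType R).
Proof.
move=> A [x0 Ax0] [u Au].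
have hA : has_sup (A : set R) by split; [exists x0 | exists u => x /Au].
exists (sup (A : set R)); split=> [x Ax|c hc].
  exact: (ub_le_sup (proj2 hA) Ax).
by apply: (ge_sup (proj1 hA)) => x /hc.
Qed.

Section Moduli.
Context {R : realType} {E : banachLatticeType R}.
Implicit Types (x y z : E) (S U V P K : {linear E -> E}) (f g : {scalar E}).

(** The dominating functional is the modulus of [f], obtained from the positive
    part [P] as [2 * P - f]. *)
Lemma functional_dominated f : bounded_functional f ->
  exists g, [/\ positive_functional g, bounded_functional g &
    forall x, 0 <=L x -> `|f x| <= g x].
Proof.
move=> /bounded_functional_pos[C C0 hC].
have [h hE] : exists h : {linear E -> R^o}, (h : E -> R^o) = f.
  by apply: linear_exists => a x y; rewrite linearP.
have [|P hP] := riesz_kantorovich (V := h) (@real_dedekind_complete R).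
  move=> x x0; exists (C * `|x|) => _ [z [z0 zx] <-]; rewrite hE.
  apply: (le_trans (ler_norm _)); apply: (le_trans (hC z)).
  by rewrite ler_pM2l // norm_le.
have [g gE] : exists g : {scalar E}, (g : E -> R) = fun x => 2 * P x - f x.
  apply: scalar_exists => a x y; rewrite linearP [f _]linearP /=.
  by rewrite -[a *: P x]/(a * P x); ring.
have Pf x : 0 <=L x -> f x <= P x.
  by move=> x0; rewrite -hE; apply: (proj1 (hP x x0)); exists x => //; split; rewrite ?vlexx.
have P0 x : 0 <=L x -> 0 <= P x.
  move=> x0; rewrite -[0](linear0 h); apply: (proj1 (hP x x0)).
  by exists 0 => //; split; rewrite ?vlexx.
have fg x : 0 <=L x -> `|f x| <= g x.
  move=> x0; have := Pf x x0; have := P0 x x0; rewrite gE ler_norml => h1 h2.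
  by apply/andP; split; lra.
have g0 : positive_functional g.
  by move=> x /fg; exact: le_trans.
exists g; split=> //; exists (3 * C) => x.
apply: (le_trans (functional_labs g0 x)); rewrite -[`|x|]norm_labs gE.
have x0 := labs_ge0 x.
have : P (labs x) <= C * `|labs x|.
  apply: (proj2 (hP _ x0)) => _ [z [z0 zx] <-]; rewrite hE.
  apply: (le_trans (ler_norm _)); apply: (le_trans (hC z)).
  by rewrite ler_pM2l // norm_le.
have := hC (labs x); rewrite ler_norml => /andP[]; lra.
Qed.

Lemma positive_part_operator V P : dedekind_complete E ->
  positive_operator P -> op_le V P ->
  exists W : {linear E -> E}, [/\ positive_operator W, op_le V W,
    forall x, 0 <=L x -> is_lub (interval_image V x) (W x) &
    forall S : {linear E -> E}, positive_operator S -> op_le V S -> op_le W S].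
Proof.
move=> ded P0 VP; have [|W hW] := riesz_kantorovich (V := V) ded.
  move=> x x0; exists (P x) => _ [z [z0 zx] <-].
  by apply: le_vle_trans (VP z z0) _; exact: positive_mono.
exists W; split=> //.
- move=> x x0; rewrite -[0](linear0 V); apply: (proj1 (hW x x0)).
  by exists 0 => //; split; rewrite ?vlexx.
- by move=> x x0; apply: (proj1 (hW x x0)); exists x => //; split; rewrite ?vlexx.
move=> S S0 VS x x0; apply: (proj2 (hW x x0)) => _ [z [z0 zx] <-].
by apply: le_vle_trans (VS z z0) _; exact: positive_mono.
Qed.

Lemma regular_linear (V : E -> E) : regular_operator V ->
  exists2 W : {linear E -> E}, (W : E -> E) = V &
    exists2 P : {linear E -> E}, positive_operator P & op_le V P.
Proof.
move=> [P [Q [P0 Q0 ->]]].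
have [W WE] : exists W : {linear E -> E}, (W : E -> E) = (P : E -> E) \- Q.
  by apply: linear_exists => a x y; rewrite /= (linearP P) (linearP Q) scalerBr opprD addrACA.
exists W => //; exists P => // x x0 /=.
by rewrite vle_subl_addr vleDl // Q0.
Qed.

Lemma zero_linear : exists Z : {linear E -> E}, forall x, Z x = 0.
Proof.
have [Z ZE] : exists Z : {linear E -> E}, (Z : E -> E) = fun=> 0.
  by apply: linear_exists => a x y /=; rewrite scaler0 addr0.
by exists Z => x; rewrite ZE.
Qed.

Lemma positive_regular (V : {linear E -> E}) : positive_operator V ->
  regular_operator V.
Proof.
move=> V0; have [Z ZE] := zero_linear.
exists V, Z; split=> // [x x0|]; first by rewrite ZE vlexx.
by apply/funext => x /=; rewrite ZE subr0.
Qed.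

(** If no nonzero positive operator were dominated both by [S] and by a
    positive operator of rank one, then [S] would be disjoint from the modulus
    of every operator of finite rank, because that modulus is itself dominated
    by an operator of rank one. *)
Lemma not_disjoint_finite_rank S : order_continuous_norm E ->
  positive_operator S -> ~ op_disjoint_complement finite_rank S ->
  exists U (psi : {scalar E}) (y : E),
    [/\ positive_operator U /\ op_le U S,
        positive_functional psi /\ bounded_functional psi, 0 <=L y,
        forall x, 0 <=L x -> U x <=L psi x *: y &
        exists2 x, 0 <=L x & U x != 0].
Proof.
move=> oc S0 nd; apply: contrapT => noU; apply: nd.
have ded := order_continuous_dedekind oc.
split=> [|_ [n [f [y [fc ->]]]]]; first exact: positive_regular.
pose Kf x := \sum_(i < n) f i x *: y i.
have [K KE] : exists K, (K : E -> E) = Kf.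
  apply: linear_exists => a u v; rewrite scaler_sumr -big_split /=.
  by apply: eq_bigr => i _; rewrite linearP /= scalerDl scalerA.
have /choice[g hg] i : exists g, [/\ positive_functional g, bounded_functional g &
    forall x, 0 <=L x -> `|f i x| <= g x].
  by apply: functional_dominated; apply/bounded_functional_continuous.
pose yy := \sum_(i < n) labs (y i).
have [psi psiE] : exists psi : {scalar E}, (psi : E -> R) = fun x => \sum_(i < n) g i x.
  apply: scalar_exists => a u v; rewrite mulr_sumr -big_split /=.
  by apply: eq_bigr => i _; rewrite linearP.
have psi0 : positive_functional psi.
  by move=> x x0; rewrite psiE sumr_ge0 // => i _; have [-> //] := hg i.
have psib : bounded_functional psi.
  have /choice[C hC] i : exists C, forall x, `|g i x| <= C * `|x|.
    by have [_ [C hC] _] := hg i; exists C.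
  exists (\sum_(i < n) C i) => x; rewrite psiE mulr_suml.
  by apply: le_trans (ler_norm_sum _ _ _) _; apply: ler_sum.
have yy0 : 0 <=L yy by apply: vsumr_ge0 => i _; exact: labs_ge0.
have [D DE] : exists D : {linear E -> E}, (D : E -> E) = fun x => psi x *: yy.
  by apply: linear_exists => a u v; rewrite linearP /= scalerDl scalerA.
have D0 : positive_operator D by move=> x x0; rewrite DE vscale_ge0 ?psi0.
have KD x : 0 <=L x -> labs (K x) <=L D x.
  move=> x0; rewrite KE DE /Kf; apply: le_vle_trans (labs_sum _ _) _.
  rewrite /yy scaler_sumr; apply: vle_sum => i _.
  rewrite labsZ vle_scale2r ?labs_ge0 // psiE.
  have [_ _ /(_ x x0) h] := hg i; apply: (le_trans h).
  rewrite (bigD1 i) //= lerDl sumr_ge0 // => j _; have [h0 _ _] := hg j.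
  exact: h0.
have KD1 : op_le K D.
  by move=> x x0; apply: le_vle_trans (vle_labs _) (KD x x0).
have [Kp [Kp0 KKp _ Kpmin]] := positive_part_operator ded D0 KD1.
have [A AE] : exists A : {linear E -> E}, (A : E -> E) = fun x => 2 *: Kp x - K x.
  apply: linear_exists => a u v; rewrite (linearP Kp) (linearP K) scalerDr !scalerA.
  by rewrite opprD addrACA -scalerN [2 * a]mulrC -scalerA -scalerDr.
have AE' x : A x = Kp x + (Kp x - K x).
  by rewrite AE -[2]/(1 + 1) scalerDl scale1r addrA.
have A0 : positive_operator A.
  by move=> x x0; rewrite AE' vaddr_ge0 ?vsubr_ge0 ?Kp0 ?KKp.
have Asup : is_op_sup K (- (K : E -> E)) A.
  split; first exact: positive_regular.
  - move=> x x0; rewrite AE' -[X in X <=L _]addr0.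
    by rewrite vleD ?KKp // vsubr_ge0 KKp.
  - move=> x x0; rewrite AE' addrA -[X in X <=L _]add0r /=.
    by rewrite vleD2r vaddr_ge0 ?Kp0.
  - move=> _ /regular_linear[V <- _] KV NKV x x0.
    have [H HE] : exists H : {linear E -> E}, (H : E -> E) = fun x => V x + K x.
      apply: linear_exists => a u v; rewrite (linearP V) (linearP K) scalerDr.
      by rewrite addrACA.
    rewrite -(vleD2r (K x)) AE subrK.
    have : Kp x <=L 2^-1 *: H x.
      have [H2 H2E] : exists H2 : {linear E -> E}, (H2 : E -> E) = fun x => 2^-1 *: H x.
        apply: linear_exists => a u v; rewrite (linearP H) scalerDr !scalerA.
        by rewrite mulrC.
      rewrite -[_ *: H x]/((fun x => 2^-1 *: H x) x) -H2E.
      apply: Kpmin => // u u0; rewrite H2E HE.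
        rewrite vscale_ge0 ?invr_ge0 // -[K u]opprK vsubr_ge0.
        exact: NKV.
      rewrite -(vle_scale2l _ _ (ltr0n R 2)) scalerA mulfV ?pnatr_eq0 //.
      by rewrite scale1r -[2]/(1 + 1) scalerDl scale1r vleD2r KV.
    move/(vle_scale (ler0n R 2)); rewrite scalerA mulfV ?pnatr_eq0 // scale1r.
    by rewrite HE.
have -> : (fun x => \sum_(i < n) f i x *: y i) = K by rewrite KE.
exists S, A; split=> //.
  split=> //; first exact: positive_regular.
  - by move=> x x0; exact: vlexx.
  - move=> x x0; apply: (@le_vle_trans _ _ 0); last exact: S0.
    by rewrite vleN0 S0.
split.
- have [Z ZE] := zero_linear.
  have -> : (0 : E -> E) = Z by apply/funext => x; rewrite ZE.
  by apply: positive_regular => x x0; rewrite ZE vlexx.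
- by move=> x x0; exact: S0.
- by move=> x x0; exact: A0.
move=> _ /regular_linear[V <- _] VS VA x x0.
have [Vp [Vp0 VVp _ Vpmin]] := positive_part_operator ded S0 VS.
suff Vp_eq0 : Vp x = 0 by have := VVp x x0; rewrite Vp_eq0.
apply/eqP; apply: contrapT => /negP Vpx; apply: noU.
exists Vp, psi, yy; split=> //; last by exists x.
- by split=> //; exact: Vpmin.
move=> u u0; rewrite -[psi u *: yy]/((fun x => psi x *: yy) u) -DE.
apply: le_vle_trans (Vpmin A A0 VA u u0) _.
have [_ _ _ Amin] := Asup; apply: Amin => //; first exact: positive_regular.
by move=> v v0; apply: le_vle_trans (vleN_labs _) (KD v v0).
Qed.
End Moduli.

(** * Irreducible semigroups *)

Section Semigroup.
Context {R : realType} {E : banachLatticeType R} (T : R -> {linear E -> E}).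
Context (scT : strongly_continuous_semigroup T) (posT : positive_semigroup T)
  (bddT : bounded_semigroup T) (irrT : irreducible_semigroup T).
Implicit Types (x y z u v : E) (t s a b e : R).

Lemma semigroup0 x : T 0 x = x. Proof. by have [] := scT. Qed.

Lemma semigroupD t s x : 0 <= t -> 0 <= s -> T (t + s) x = T t (T s x).
Proof. by move=> t0 s0; have [_ _ ->] := scT. Qed.

Lemma semigroupC t s x : 0 <= t -> 0 <= s -> T t (T s x) = T s (T t x).
Proof. by move=> t0 s0; rewrite -!semigroupD // addrC. Qed.

Lemma semigroup_bound : exists2 M, 0 < M & forall t, 0 <= t -> forall x, `|T t x| <= M * `|x|.
Proof.
have [M hM] := bddT; exists (`|M| + 1) => [|t t0 x]; first by rewrite ltr_wpDl.
apply: le_trans (hM t t0 x) _; apply: ler_wpM2r => //.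
by rewrite (le_trans (ler_norm M)) // lerDl.
Qed.

Lemma semigroup_right_continuous x e : 0 < e ->
  exists2 r, 0 < r & forall s, 0 <= s -> s < r -> `|T s x - x| < e.
Proof.
move=> e0; have [_ _ _ /(_ x)/continuous_within_itvcyP[_]] := scT.
move=> /cvgrPdist_lt /(_ e e0)[r /= r0 hr].
exists r => // s; rewrite le_eqVlt => /orP[/eqP<- _|s0 sr].
  by rewrite semigroup0 subrr normr0.
rewrite distrC -{1}(semigroup0 x); apply: hr => //=.
by rewrite add0r normrN gtr0_norm.
Qed.

Lemma closed_of_approx (A : set E) :
  (forall x, (forall e, 0 < e -> exists2 y, A y & `|x - y| < e) -> A x) -> closed A.
Proof.
move=> h x Ax; apply: h => e e0.
have [y [Ay yx]] := Ax (ball x e) (nbhsx_ballx x e e0).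
by exists y => //; move: yx; rewrite -ball_normE.
Qed.

(** The vectors whose modulus has an orbit annihilated by [w] form a closed
    invariant ideal. *)
Lemma irreducible_functional (w : {scalar E}) :
  positive_functional w -> bounded_functional w -> (exists x, w x != 0) ->
  forall v, 0 <=L v -> v != 0 -> exists2 b, 0 <= b & 0 < w (T b v).
Proof.
move=> w0 wb [x0 wx0] v v0 vn0; apply: contrapT => nob.
have Tb0 b x : 0 <= b -> 0 <=L x -> 0 <= w (T b x).
  by move=> b0 x0'; apply: w0; apply: posT.
have Tmono b x y : 0 <= b -> x <=L y -> w (T b x) <= w (T b y).
  by move=> b0 xy; rewrite functional_mono // positive_mono //; exact: posT.
pose J := [set x | forall b, 0 <= b -> w (T b (labs x)) = 0].
have Jsolid x y : J x -> labs y <=L labs x -> J y.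
  move=> Jx yx b b0; apply/eqP; rewrite eq_le Tb0 ?labs_ge0 // andbT.
  by rewrite -(Jx b b0) Tmono.
have [] := irrT (J := J).
- split=> //; first by move=> b b0; rewrite labs0 !linear0.
  move=> a x y Jx Jy b b0; apply/eqP; rewrite eq_le Tb0 ?labs_ge0 // andbT.
  apply: le_trans (Tmono _ _ _ b0 (labsD _ _)) _.
  by rewrite linearD [w _]linearD Jy // addr0 labsZ linearZ linearZ /= Jx // mulr0.
- apply: closed_of_approx => x hx b b0.
  have [C C0 hC] := bounded_functional_pos wb.
  have [M M0 hM] := semigroup_bound.
  apply/eqP; rewrite eq_le Tb0 ?labs_ge0 // andbT; apply/ler_addgt0Pr => e e0.
  have [y Jy xy] := hx (e / (C * M)) (divr_gt0 e0 (mulr_gt0 C0 M0)).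
  rewrite add0r -[leLHS]subr0 -(Jy b b0) -!linearB.
  apply: le_trans (ler_norm _) _; apply: le_trans (hC _) _.
  have : `|labs x - labs y| <= e / (C * M).
    exact: le_trans (norm_labs_lip _ _) (ltW xy).
  rewrite ler_pdivlMr ?mulr_gt0 // => h; apply: le_trans h.
  by rewrite [leRHS]mulrCA ler_pM2l // mulrC hM.
- move=> t t0 _ [x Jx <-] b b0; apply/eqP; rewrite eq_le Tb0 ?labs_ge0 // andbT.
  rewrite -(Jx (b + t)) ?addr_ge0 // semigroupD //.
  by apply: Tmono => //; apply: positive_labs; exact: posT.
- move=> J0; have : J v.
    move=> b b0; rewrite labs_id //; apply/eqP; rewrite eq_le Tb0 // andbT leNgt.
    by apply/negP => wb0; apply: nob; exists b.
  by rewrite J0 => /eqP; exact/negP.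
move=> JT; have : J x0 by rewrite JT.
move=> /(_ 0 (lexx _)); rewrite semigroup0 => h.
have := functional_labs w0 x0; rewrite h normr_le0; exact/negP.
Qed.

(** The closure of the principal ideal of a fixed vector is invariant. *)
Lemma fixed_principal_dense u : 0 <=L u -> u != 0 -> Fix T u ->
  forall x e, 0 < e -> exists2 y, principal_ideal u y & `|x - y| < e.
Proof.
move=> u0 un0 Fu x e; move: e x.
pose J := [set x | forall e, 0 < e -> exists2 y, principal_ideal u y & `|x - y| < e].
have PJ x : principal_ideal u x -> J x by move=> h e e0; exists x => //; rewrite subrr normr0.
have P0 : principal_ideal u 0 by exists 1 => //; rewrite labs0 scale1r.
have PD a x y : principal_ideal u x -> principal_ideal u y -> principal_ideal u (a *: x + y).
  move=> [c c0 xc] [d d0 yd]; exists (`|a| * c + d); first by rewrite ltr_wpDl ?mulr_ge0 // ltW.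
  apply: le_vle_trans (labsD _ _) _; rewrite scalerDl vleD // labsZ -scalerA.
  exact: vle_scale.
have [] := irrT (J := J).
- split; first exact: PJ.
    move=> a x y Jx Jy e e0.
    have a0 : 0 < `|a| + 1 by rewrite ltr_wpDl.
    have [p Pp xp] := Jx (e / 2 / (`|a| + 1)) (divr_gt0 (divr_gt0 e0 (ltr0n R 2)) a0).
    have [q Pq yq] := Jy (e / 2) (divr_gt0 e0 (ltr0n R 2)).
    exists (a *: p + q); first exact: PD.
    rewrite opprD addrACA -scalerBr (splitr e).
    apply: le_lt_trans (ler_normD _ _) (ler_ltD _ yq).
    rewrite normrZ; move: xp; rewrite ltr_pdivlMr // => /ltW; apply: le_trans.
    by rewrite mulrC ler_wpM2l // lerDl.
  move=> x y Jx yx e e0.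
  have [p [c c0 pc] xp] := Jx (e / 2) (divr_gt0 e0 (ltr0n R 2)).
  (* the truncation of a positive vector at level |p| *)
  pose tr z := z - vpos (z - labs p).
  have tr0 z : 0 <=L z -> 0 <=L tr z.
    by move=> z0; rewrite vsubr_ge0 vjoin_le z0 vle_subl_addr vleDl // labs_ge0.
  have trp z : tr z <=L labs p.
    by rewrite vle_subl_addr addrC -vle_subl_addr vle_vpos.
  have tre z : 0 <=L z -> z <=L labs x -> `|z - tr z| <= `|x - p|.
    move=> z0 zx; rewrite opprB addrC subrK; apply: le_trans (norm_labs_lip x p).
    apply: le_trans (norm_vpos _); apply: norm_le; first exact: vpos_ge0.
    rewrite vjoin_le vpos_ge0 andbT; apply: le_vle_trans (vle_vpos _).
    by rewrite vleD2r.
  have vx : vpos y <=L labs x by apply: le_vle_trans (vpos_le_labs _) yx.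
  have vnx : vpos (- y) <=L labs x.
    by apply: le_vle_trans (vpos_le_labs _) _; rewrite labsN.
  exists (tr (vpos y) - tr (vpos (- y))).
    exists (c + c); first by rewrite addr_gt0.
    apply: le_vle_trans (labsB _ _) _; rewrite !labs_id ?tr0 ?vpos_ge0 // scalerDl.
    by apply: vleD; exact: le_vle_trans (trp _) pc.
  have -> : y - (tr (vpos y) - tr (vpos (- y))) =
      (vpos y - tr (vpos y)) - (vpos (- y) - tr (vpos (- y))).
    rewrite -{1}(vposB y) !opprB addrACA [RHS]addrACA; congr (_ + _).
    exact: addrC.
  rewrite (splitr e); apply: le_lt_trans (ler_normB _ _) _.
  by apply: ltrD; apply: le_lt_trans (tre _ _ _) xp; rewrite ?vpos_ge0.
- apply: closed_of_approx => x hx e e0.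
  have [y Jy xy] := hx (e / 2) (divr_gt0 e0 (ltr0n R 2)).
  have [z Pz yz] := Jy (e / 2) (divr_gt0 e0 (ltr0n R 2)).
  exists z => //; rewrite -(subrK y x) -addrA (splitr e).
  by rewrite (le_lt_trans (ler_normD _ _)) // ltrD.
- move=> t t0 _ [x Jx <-] e e0; have [M M0 hM] := semigroup_bound.
  have [p [c c0 pc] xp] := Jx (e / M) (divr_gt0 e0 M0).
  exists (T t p).
    exists c => //; apply: le_vle_trans (positive_labs (posT t0) _) _.
    by rewrite -(Fu t t0) -linearZ; apply: positive_mono pc; exact: posT.
  rewrite -linearB; apply: le_lt_trans (hM t t0 _) _.
  by rewrite mulrC -ltr_pdivlMr.
- move=> J0; have : J u by apply: PJ; exists 1; rewrite ?labs_id ?scale1r ?vlexx.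
  by rewrite J0 => /eqP; move/negP : un0.
by move=> JT e x e0; have : J x by [rewrite JT]; exact.
Qed.
End Semigroup.

(** * Invariant functionals *)

Section GeneralizedLimit.
Context {R : realType}.

Definition bounded_sequence (u : nat -> R) : Prop := exists C : R, forall n, `|u n| <= C.

(** A limit along an ultrafilter finer than [\oo]. *)
Lemma generalized_limit : exists L : (nat -> R) -> R,
  [/\ forall (a : R) u v, bounded_sequence u -> bounded_sequence v ->
        L (fun n => a * u n + v n) = a * L u + L v,
      forall (c : R) u, bounded_sequence u -> (forall n, c <= u n) -> c <= L u &
      forall u, (forall e : R, 0 < e -> exists N, forall n, (N <= n)%N -> `|u n| <= e) ->
        L u = 0].
Proof.
have [U [ultraU UN]] := @ultraFilterLemma nat \oo _.
have cvgU u : bounded_sequence u -> cvg (u @ U).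
  move=> [C hC]; have ultru : UltraFilter (u @ U).
    apply: Build_UltraFilter => G GP sG; apply/seteqP; split=> [A GA|]; last exact: sG.
    have [//|UA] := in_ultra_setVsetC (u @^-1` A) ultraU.
    have GnA : G (~` A) by apply: sG.
    by have := filter_ex (filterI GA GnA) => -[x []].
  have : compact `[- C, C]%classic by exact: segment_compact.
  rewrite compact_ultra => /(_ _ ultru)[|l [_ ul]].
    by apply: nearW => n /=; rewrite in_itv /= -ler_norml.
  by apply/cvg_ex; exists l.
exists (fun u => lim (u @ U)); split.
- move=> a u v /cvgU cu /cvgU cv; apply: cvg_lim => //.
  by apply: cvgD => //; apply: cvgM => //; exact: cvg_cst.
- move=> c u /cvgU cu hc; apply: limr_ge => //; exact: nearW.
move=> u hu; apply: cvg_lim => //; apply: (cvg_trans (G := u @ \oo)).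
  by move=> A; exact: UN.
apply/cvgrPdist_le => e /hu[N hN]; exists N => // n /= Nn.
by rewrite sub0r normrN hN.
Qed.
End GeneralizedLimit.

(** All but the first and the last [m] terms cancel. *)
Lemma shifted_sum (R : realType) (g : nat -> R) (K : R) (n m : nat) :
  (forall j, `|g j| <= K) ->
  `|\sum_(j < n) g (j + m)%N - \sum_(j < n) g j| <= 2 * m%:R * K.
Proof.
move=> gK; elim: m => [|m IH].
  under eq_bigr do rewrite addn0.
  by rewrite subrr normr0 mulr0 mul0r.
have -> : \sum_(j < n) g (j + m.+1)%N = \sum_(j < n) g (j + m)%N + (g (n + m)%N - g m).
  elim: n {IH} => [|n IHn]; first by rewrite !big_ord0 add0n subrr addr0.
  by rewrite !big_ord_recr /= IHn addnS -addSn; ring.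
rewrite addrAC; apply: le_trans (ler_normD _ _) _.
have := ler_normB (g (n + m)%N) (g m); have := gK m; have := gK (n + m)%N.
by rewrite -[m.+1%:R]natr1 mulrDr mulrDl mulr1; lra.
Qed.

Section FixedFunctional.
Context {R : realType} {E : banachLatticeType R} (T : R -> {linear E -> E}).
Context (scT : strongly_continuous_semigroup T) (posT : positive_semigroup T)
  (bddT : bounded_semigroup T).
Implicit Types (x y z u v : E) (t s a b e : R).

(** Generalized limit of the averages of [psi o T] over the times
    [j / (k + 1)], [j < (k + 1) ^ 2]: they exhaust the half-line, with a mesh
    that tends to [0]. *)
Lemma invariant_functional (psi : {scalar E}) :
  positive_functional psi -> bounded_functional psi ->
  exists phi : {scalar E}, [/\ positive_functional phi, bounded_functional phi,
    forall t, 0 <= t -> forall x, phi (T t x) = phi x &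
    forall x, (forall t, 0 <= t -> psi x <= psi (T t x)) -> psi x <= phi x].
Proof.
move=> psi0 psib.
have [C C0 hC] := bounded_functional_pos psib.
have [M M0 hM] := semigroup_bound bddT.
have [L [Llin Lge L0]] := @generalized_limit R.
pose tm (k j : nat) : R := j%:R / k.+1%:R.
have tm0 k j : 0 <= tm k j by rewrite divr_ge0.
pose N k := (k.+1 ^ 2)%N.
have N0 k : 0 < (N k)%:R :> R by rewrite ltr0n expn_gt0.
pose avg x k := (N k)%:R^-1 * \sum_(j < N k) psi (T (tm k j) x).
have bT t x : 0 <= t -> `|psi (T t x)| <= C * M * `|x|.
  by move=> t0; apply: le_trans (hC _) _; rewrite -mulrA ler_pM2l // hM.
have avg_ge c x k : (forall t, 0 <= t -> c <= psi (T t x)) -> c <= avg x k.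
  move=> hc; rewrite /avg mulrC ler_pdivlMr // mulr_natr.
  rewrite -[leLHS](_ : \sum_(j < N k) c = _); last by rewrite sumr_const card_ord.
  by apply: ler_sum => j _; exact: hc.
have avg_lin a x y k : avg (a *: x + y) k = a * avg x k + avg y k.
  rewrite /avg mulrCA -mulrDr [a * _]mulr_sumr -big_split /=; congr (_ * _).
  by apply: eq_bigr => j _; rewrite !linearP.
have avg_abs B x k : (forall t, 0 <= t -> `|psi (T t x)| <= B) -> `|avg x k| <= B.
  move=> hB; rewrite ler_norml; apply/andP; split.
    by apply: avg_ge => t t0; have := hB t t0; rewrite ler_norml => /andP[].
  have a0 : avg 0 k = 0 by rewrite /avg big1 ?mulr0 // => j _; rewrite !linear0.
  have aN : avg (- x) k = - avg x k.
    by rewrite -scaleN1r -[_ *: x]addr0 avg_lin a0 addr0 mulN1r.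
  rewrite -lerN2 -aN; apply: avg_ge => t t0; have := hB t t0.
  by rewrite !linearN lerN2 => /(le_trans (ler_norm _)).
have avgb x : bounded_sequence (avg x).
  by exists (C * M * `|x|) => k; apply: avg_abs => t t0; exact: bT.
have [phi phiE] : exists phi : {scalar E}, (phi : E -> R) = fun x => L (avg x).
  apply: scalar_exists => a x y; rewrite -Llin //; congr L.
  by apply/funext => k; exact: avg_lin.
have phi_ge c x : (forall t, 0 <= t -> c <= psi (T t x)) -> c <= phi x.
  by move=> h; rewrite phiE; apply: Lge => // k; exact: avg_ge.
exists phi; split.
- by move=> x x0; apply: phi_ge => t t0; apply: psi0; exact: posT.
- exists (C * M) => x; rewrite ler_norml; apply/andP; split.
    by apply: phi_ge => t t0; have := bT t x t0; rewrite ler_norml => /andP[].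
  rewrite -lerN2 -linearN; apply: phi_ge => t t0.
  by have := bT t (- x) t0; rewrite normrN ler_norml => /andP[].
- move=> r r0 x; apply/eqP; rewrite -subr_eq0 -linearB; apply/eqP.
  rewrite phiE; apply: L0 => e e0.
  pose K := C * M * `|x|; pose K1 := K + 1.
  have K0 : 0 <= K by rewrite !mulr_ge0 // ltW.
  have [d d0 hd] := semigroup_right_continuous scT x
    (divr_gt0 (divr_gt0 e0 (ltr0n R 2)) (mulr_gt0 C0 M0)).
  have D0 : 0 < 4 * (r + 1) * (K + 1) by rewrite !mulr_gt0 ?ltr_wpDl.
  have [N1 hN1] := invSn_lt d0; have [N2 hN2] := invSn_lt (divr_gt0 e0 D0).
  exists (maxn N1 N2) => k; rewrite geq_max => /andP[/hN1 k1 /hN2 k2].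
  pose m := Num.truncn (r * k.+1%:R).
  have /andP[m1 m2] := truncn_itv (mulr_ge0 r0 (ler0n R k.+1)).
  rewrite -/m in m1 m2.
  have tmr : tm k m <= r by rewrite ler_pdivrMr.
  have rtm : r - tm k m < d.
    apply: le_lt_trans k1; rewrite lerBlDl.
    rewrite (_ : tm k m + _ = m.+1%:R / k.+1%:R); last first.
      by rewrite -[m.+1%:R]natr1 mulrDl mul1r.
    by rewrite ler_pdivlMr // ltW.
  (* the error made by replacing [r] with a multiple of the mesh *)
  have err1 : `|avg (T r x - T (tm k m) x) k| <= e / 2.
    apply: avg_abs => t t0.
    rewrite -{1}(subrK (tm k m) r) [r - _ + _]addrC semigroupD ?subr_ge0 //.
    rewrite -linearB -semigroupD //; apply: le_trans (hC _) _.
    apply: le_trans (ler_wpM2l (ltW C0) (hM _ (addr_ge0 t0 (tm0 _ _)) _)) _.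
    have := hd _ (_ : 0 <= r - tm k m) rtm; rewrite subr_ge0 => /(_ tmr).
    by rewrite ltr_pdivlMr ?mulr_gt0 // => /ltW; rewrite mulrC mulrA.
  have err2 : `|avg (T (tm k m) x - x) k| <= e / 2.
    rewrite /avg normrM gtr0_norm ?invr_gt0 // mulrC ler_pdivrMr //.
    under eq_bigr do rewrite linearB linearB.
    rewrite sumrB.
    have -> : \sum_(j < N k) psi (T (tm k j) (T (tm k m) x)) =
        \sum_(j < N k) psi (T (tm k (j + m)%N) x).
      by apply: eq_bigr => j _; rewrite -semigroupD // /tm natrD mulrDl.
    apply: le_trans (@shifted_sum R (fun j => psi (T (tm k j) x)) K _ m _) _.
      by move=> j; exact: bT.
    have kN : (N k)%:R = k.+1%:R * k.+1%:R :> R by rewrite /N expnS expn1 natrM.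
    have k0 : (0 < k.+1%:R :> R) by rewrite ltr0n.
    move: k2; rewrite ltr_pdivlMr // mulrC ltr_pdivrMr // => k2.
    have h1 : m%:R * K <= r * k.+1%:R * K by apply: ler_wpM2r.
    have h2 : r * K <= (r + 1) * (K + 1).
      by rewrite ler_pM // lerDl.
    rewrite kN; apply: (@le_trans _ _ (2 * ((r + 1) * (K + 1) * k.+1%:R))).
      rewrite -mulrA ler_pM2l //; apply: (le_trans h1).
      by rewrite mulrAC ler_pM2r.
    rewrite !mulrA ler_pM2r //; lra.
  have -> : T r x - x = 1 *: (T r x - T (tm k m) x) + (T (tm k m) x - x).
    by rewrite scale1r addrA subrK.
  rewrite avg_lin mul1r (splitr e); apply: le_trans (ler_normD _ _) _.
  exact: lerD.
by move=> x h; exact: phi_ge.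
Qed.
End FixedFunctional.

(** * Fixed vectors *)

Section MarkovPair.
Context {R : realType} {E : banachLatticeType R} (T : R -> {linear E -> E}).
Context (scT : strongly_continuous_semigroup T) (posT : positive_semigroup T)
  (bddT : bounded_semigroup T) (irrT : irreducible_semigroup T).
Implicit Types (x y z u v : E) (t s a b e : R).

Lemma strictly_positive_pos (phi : {scalar E}) : strictly_positive phi ->
  forall x, 0 <=L x -> x != 0 -> 0 < phi x.
Proof. by move=> [_ h] x x0 /h; rewrite labs_id. Qed.

Lemma strictly_positive_eq0 (phi : {scalar E}) : strictly_positive phi ->
  forall x, 0 <=L x -> phi x = 0 -> x = 0.
Proof.
move=> sp x x0 px; apply/eqP; apply: contrapT => /negP /(strictly_positive_pos sp x0).
by rewrite px ltxx.
Qed.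

(** The vector [T t (labs x) - labs x] is positive and [phi] vanishes on it. *)
Lemma fixed_labs (phi : {scalar E}) : strictly_positive phi ->
  (forall t, 0 <= t -> forall x, phi (T t x) = phi x) ->
  forall x, Fix T x -> Fix T (labs x).
Proof.
move=> sp inv x Fx t t0; apply/eqP; rewrite -subr_eq0; apply/eqP.
apply: (strictly_positive_eq0 sp); last by rewrite linearB /= inv // subrr.
rewrite vsubr_ge0 -{1}(Fx t t0); exact: positive_labs (posT t0) _.
Qed.

(** For a fixed vector [x0], the function [t |-> psi (T t (labs x0))] is bounded
    below by its value at [0], so that the invariant functional built from a
    translate of [psi] does not vanish on [labs x0]; irreducibility makes it
    strictly positive. *)
Lemma markov_pair (psi : {scalar E}) :
  positive_functional psi -> bounded_functional psi -> (exists x, psi x != 0) ->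
  Fix T <> [set 0] ->
  exists (phi : {scalar E}) h, [/\ strictly_positive phi, bounded_functional phi,
    forall t, 0 <= t -> forall x, phi (T t x) = phi x,
    Fix T h /\ 0 <=L h & phi h = 1].
Proof.
move=> psi0 psib psin0 Fn.
have [x0 [Fx0 x0n]] : exists x, Fix T x /\ x != 0.
  apply: contrapT => h; apply: Fn; apply/seteqP; split=> [x Fx|_ ->].
    by apply/eqP; apply: contrapT => /negP xn; apply: h; exists x.
  by move=> t t0; rewrite linear0.
have lx0 : labs x0 != 0 by apply: contra_neq x0n; exact: labs_eq0.
have [s s0 hs] := irreducible_functional scT posT bddT irrT psi0 psib psin0
  (labs_ge0 x0) lx0.
have [psi' psiE] : exists f : {scalar E}, (f : E -> R) = psi \o T s.
  by apply: scalar_exists => a x y /=; rewrite !linearP.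
have [phi [phi0 phib phiT phi_ge]] : exists phi : {scalar E},
    [/\ positive_functional phi, bounded_functional phi,
    forall t, 0 <= t -> forall x, phi (T t x) = phi x &
    forall x, (forall t, 0 <= t -> psi' x <= psi' (T t x)) -> psi' x <= phi x].
  apply: (invariant_functional scT posT bddT); rewrite psiE.
    by move=> x x_ge0; apply: psi0; exact: posT.
  apply: bounded_functional_comp => //; have [+ _ _ _] := scT; exact.
have phix0 : 0 < phi (labs x0).
  apply: (lt_le_trans hs); have := phi_ge (labs x0); rewrite psiE /=; apply.
  move=> t t0; apply: functional_mono => //; apply: positive_mono; first exact: posT.
  by rewrite -{1}(Fx0 t t0); exact: positive_labs (posT t0) _.
have sp : strictly_positive phi.
  split=> // x xn0.
  have lx : labs x != 0 by apply: contra_neq xn0; exact: labs_eq0.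
  have [|b b0] := irreducible_functional scT posT bddT irrT phi0 phib _
    (labs_ge0 x) lx; last by rewrite phiT.
  by exists (labs x0); rewrite gt_eqF.
have [f fE] : exists f : {scalar E}, (f : E -> R) = fun x => phi x / phi (labs x0).
  by apply: scalar_exists => a x y; rewrite linearP /= mulrDl mulrA.
exists f, (labs x0); split.
- split=> [x x_ge0|x xn0]; rewrite fE; first by rewrite divr_ge0 ?phi0 ?labs_ge0.
  by rewrite divr_gt0 //; have [_ ->] := sp.
- have [C hC] := phib; exists (C / phi (labs x0)) => x.
  rewrite fE normrM [X in _ * X]gtr0_norm ?invr_gt0 // mulrAC ler_pM2r ?invr_gt0 //.
- by move=> t t0 x; rewrite fE phiT.
- by split; [exact: (fixed_labs sp phiT Fx0) | exact: labs_ge0].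
by rewrite fE divff // gt_eqF.
Qed.

(** The two parts of a fixed vector of mean zero are fixed and disjoint, and a
    nonzero fixed positive vector generates a dense ideal, so that one of the
    parts vanishes. *)
Lemma fixed_multiple (phi : {scalar E}) h : strictly_positive phi ->
  (forall t, 0 <= t -> forall x, phi (T t x) = phi x) ->
  Fix T h -> phi h = 1 -> forall c, Fix T c -> c = phi c *: h.
Proof.
move=> sp inv Fh h1 c Fc.
pose v := c - phi c *: h.
have Fv : Fix T v by move=> t t0; rewrite linearB linearZ /= Fc // Fh.
have phiv : phi v = 0 by rewrite linearB linearZ /= h1 mulr1 subrr.
have Fp : Fix T (vpos v).
  have lv : labs v + v = 2 *: vpos v.
    rewrite labsE vposN -[2]/(1 + 1) scalerDl scale1r -addrA subrK //.
  have -> : vpos v = 2^-1 *: (labs v + v).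
    by rewrite lv scalerA mulVf ?pnatr_eq0 // scale1r.
  by move=> t t0; rewrite linearZ linearD /= (fixed_labs sp inv Fv) // Fv.
have n0 : vpos v != 0 -> vpos (- v) = 0.
  move=> pn0; apply/eqP; rewrite -normr_le0; apply/ler_addgt0Pr => e e0.
  rewrite add0r; set n := vpos (- v).
  have [y [k k0 yk] ny] := fixed_principal_dense posT bddT irrT
    (vpos_ge0 v) pn0 Fp n e0.
  apply: le_trans (ltW ny); rewrite -[leRHS]norm_labs; apply: norm_le; first exact: vpos_ge0.
  have k1 : 0 < 1 + k by rewrite addr_gt0.
  (* [n] is disjoint from [k *: vpos v], hence equal to its excess over it *)
  have z0 : n - vpos (n - k *: vpos v) <=L 0.
    rewrite -(vle_scale2l _ _ (a := (1 + k)^-1)) ?invr_gt0 // scaler0.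
    rewrite -(vpos_disj v); apply: vmeet_glb.
      rewrite -(vle_scale2l _ _ k1) scalerA mulfV ?gt_eqF // scale1r.
      rewrite vle_subl_addr addrC -vle_subl_addr.
      apply: le_vle_trans (vle_vpos _); rewrite vleD2l vleN2.
      by apply: vle_scale2r; rewrite ?vpos_ge0 // lerDr.
    rewrite -(vle_scale2l _ _ k1) scalerA mulfV ?gt_eqF // scale1r.
    rewrite -/n scalerDl scale1r vle_subl_addr -addrA vleDl // vaddr_ge0 ?vpos_ge0 //.
    by rewrite vscale_ge0 ?vpos_ge0 ?ltW.
  move: z0; rewrite vle_subl_addr add0r => /le_vle_trans; apply.
  rewrite vjoin_le labs_ge0 andbT.
  apply: (@le_vle_trans _ _ (n - labs y)); first by rewrite vleD2l vleN2.
  rewrite -[n in n - _](labs_id (vpos_ge0 (- v))).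
  exact: le_vle_trans (vle_labs _) (labs_lip _ _).
have pe : phi (vpos v) = phi (vpos (- v)).
  by apply/eqP; rewrite -subr_eq0 -linearB vposB; apply/eqP.
have p0 : vpos v = 0.
  apply/eqP; apply: contrapT => /negP pn0.
  have := strictly_positive_pos sp (vpos_ge0 v) pn0.
  by rewrite pe n0 // linear0 ltxx.
have m0 : vpos (- v) = 0.
  by apply: (strictly_positive_eq0 sp); rewrite ?vpos_ge0 // -pe p0 linear0.
by apply/eqP; rewrite -subr_eq0 -/v -(vposB v) p0 m0 subrr.
Qed.
End MarkovPair.

(** * Quadratic forms *)

Section QuadraticForms.
Context {R : realType}.

(** The deviation [g t - t * g 1] is additive and vanishes on the integers, hence
    it is bounded on the half-line; but its values at the multiples of [t] are
    the multiples of its value at [t]. *)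
Lemma additive_bounded_linear (g : R -> R) (K : R) :
  (forall s t, g (s + t) = g s + g t) -> (forall t, `|t| <= 1 -> `|g t| <= K) ->
  forall t, g t = t * g 1.
Proof.
move=> gD gK; pose h t := g t - t * g 1.
have hD s t : h (s + t) = h s + h t by rewrite /h gD; ring.
have h1 : h 1 = 0 by rewrite /h mul1r subrr.
have h0 : h 0 = 0 by have := hD 0 0; rewrite addr0; lra.
have hM n t : h (n%:R * t) = n%:R * h t.
  elim: n => [|n IH]; first by rewrite !mul0r.
  by rewrite -natr1 !mulrDl !mul1r hD IH.
have hn n : h n%:R = 0 by rewrite -[n%:R]mulr1 hM h1 mulr0.
have hK t : 0 <= t -> `|h t| <= K + `|g 1|.
  move=> t0; have /andP[t1 t2] := truncn_itv t0; set m := Num.truncn t in t1 t2.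
  have -> : h t = h (t - m%:R) by rewrite -{1}(subrK m%:R t) hD hn addr0.
  have d1 : `|t - m%:R| <= 1.
    rewrite ger0_norm ?subr_ge0 // lerBlDl natr1; exact: ltW.
  apply: le_trans (ler_normB _ _) _; apply: lerD; first exact: gK.
  by rewrite normrM ler_piMl.
have h_eq0 t : 0 <= t -> h t = 0.
  move=> t0; apply/eqP; rewrite -normr_le0 leNgt; apply/negP => ht.
  have := archi_boundP (divr_ge0 (le_trans (normr_ge0 _) (hK t t0)) (normr_ge0 (h t))).
  rewrite ltr_pdivrMr // ltNge => /negP; apply.
  by rewrite -[n in n%:R * _]/(_) -{1}[_%:R]ger0_norm // -normrM -hM hK // mulr_ge0.
move=> t; suff : h t = 0 by rewrite /h => /eqP; rewrite subr_eq0 => /eqP.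
have [t0|t0] := leP 0 t; first exact: h_eq0.
have := hD t (- t); rewrite subrr h0 [h (- t)]h_eq0 ?addr0 //.
by rewrite oppr_ge0 ltW.
Qed.

(** The Jordan-von Neumann theorem, for a form [N] that is controlled on the
    subspace [I] only. *)

Section ParallelogramLaw.
Context {V : lmodType R} (I : V -> Prop) (N : V -> R).
Context (I0 : I 0) (IP : forall (a : R) x y, I x -> I y -> I (a *: x + y)).
Context (N_ge0 : forall x, I x -> 0 <= N x).
Context (N_par : forall x y, I x -> I y -> N (x + y) + N (x - y) = 2 * N x + 2 * N y).
Context (N_bound : forall x y, I x -> I y ->
  exists K : R, forall t : R, `|t| <= 1 -> N (t *: x + y) <= K).

Definition polar x y : R := (N (x + y) - N (x - y)) / 4.

Lemma subspaceD x y : I x -> I y -> I (x + y).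
Proof. by move=> Ix Iy; rewrite -[x]scale1r; exact: IP. Qed.
Lemma subspaceZ (a : R) x : I x -> I (a *: x).
Proof. by move=> Ix; rewrite -[_ *: x]addr0; exact: IP. Qed.
Lemma subspaceN x : I x -> I (- x).
Proof. by move=> Ix; rewrite -scaleN1r; exact: subspaceZ. Qed.
Lemma subspaceB x y : I x -> I y -> I (x - y).
Proof. by move=> Ix Iy; apply: subspaceD => //; exact: subspaceN. Qed.
Lemma subspace_sum (n : nat) (F : nat -> V) :
  (forall i, (i < n)%N -> I (F i)) -> I (\sum_(i < n) F i).
Proof.
elim: n => [|n IH] h; first by rewrite big_ord0.
rewrite big_ord_recr /=; apply: subspaceD; last exact: h.
by apply: IH => i ni; apply: h; rewrite ltnW.
Qed.

Lemma quadratic0 : N 0 = 0.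
Proof. by have := N_par I0 I0; rewrite subrr addr0; lra. Qed.

Lemma quadraticN x : I x -> N (- x) = N x.
Proof. by move=> Ix; have := N_par I0 Ix; rewrite add0r sub0r quadratic0; lra. Qed.

Lemma polarC x y : I x -> I y -> polar x y = polar y x.
Proof.
by move=> Ix Iy; rewrite /polar [x + y]addrC -[x - y]opprB quadraticN //; exact: subspaceB.
Qed.

Lemma polarxx x : I x -> polar x x = N x.
Proof.
move=> Ix; rewrite /polar subrr quadratic0; have := N_par Ix Ix.
by rewrite subrr quadratic0 => h; lra.
Qed.

Lemma polarDl x x' y : I x -> I x' -> I y ->
  polar (x + x') y = polar x y + polar x' y.
Proof.
move=> Ix Ix' Iy.
have key u : I u -> N (x + x' + u) =
    N (x + u) + N (x' + u) + N x + N x' - N u - N (x - x').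
  move=> Iu.
  have h1 := N_par (subspaceD Ix Iu) Ix'.
  have h2 := N_par (subspaceD Ix' Iu) Ix.
  have h3 := N_par Iu (subspaceB Ix Ix').
  have e1 : x + u + x' = x + x' + u by rewrite addrAC.
  have e2 : x' + u + x = x + x' + u by rewrite addrAC [x' + x]addrC.
  have e3 : x + u - x' = u + (x - x') by rewrite addrAC addrC.
  have e4 : x' + u - x = u - (x - x') by rewrite addrAC addrC opprB.
  by rewrite e1 e3 in h1; rewrite e2 e4 in h2; lra.
rewrite /polar key // [N (x + x' - y)]key ?quadraticN //; last exact: subspaceN.
by rewrite -mulrDl; congr (_ / _); ring.
Qed.

Lemma polarZl (a : R) x y : I x -> I y -> polar (a *: x) y = a * polar x y.
Proof.
move=> Ix Iy.
have [K1 h1] := N_bound Ix Iy; have [K2 h2] := N_bound Ix (subspaceN Iy).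
rewrite (@additive_bounded_linear (fun t => polar (t *: x) y) (`|K1| + `|K2|)).
- by rewrite scale1r.
- by move=> s t; rewrite scalerDl polarDl //; exact: subspaceZ.
move=> t t1.
have p1 := N_ge0 (subspaceD (subspaceZ t Ix) Iy).
have p2 := N_ge0 (subspaceB (subspaceZ t Ix) Iy).
have q1 := le_trans (h1 t t1) (ler_norm K1).
have q2 := le_trans (h2 t t1) (ler_norm K2).
have r1 := normr_ge0 K1; have r2 := normr_ge0 K2.
by rewrite /polar ler_norml; apply/andP; split; lra.
Qed.

Lemma polarDr x y y' : I x -> I y -> I y' ->
  polar x (y + y') = polar x y + polar x y'.
Proof.
move=> Ix Iy Iy'.
by rewrite polarC ?polarDl ?[polar x y]polarC ?[polar x y']polarC //; exact: subspaceD.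
Qed.

Lemma polarZr (a : R) x y : I x -> I y -> polar x (a *: y) = a * polar x y.
Proof.
move=> Ix Iy.
by rewrite polarC ?polarZl ?[polar x y]polarC //; exact: subspaceZ.
Qed.

Lemma polar_sumr x n (F : nat -> V) : I x -> (forall i, (i < n)%N -> I (F i)) ->
  polar x (\sum_(i < n) F i) = \sum_(i < n) polar x (F i).
Proof.
move=> Ix; elim: n => [|n IH] h.
  by rewrite !big_ord0 -[0 in LHS](scale0r 0) polarZr // mul0r.
have h' i : (i < n)%N -> I (F i) by move=> ni; apply: h; rewrite ltnW.
rewrite !big_ord_recr /= polarDr ?IH //; [exact: subspace_sum | exact: h].
Qed.

Lemma quadraticD x y : I x -> I y -> N (x + y) = N x + N y + 2 * polar x y.
Proof.
move=> Ix Iy; have := N_par Ix Iy; rewrite /polar; lra.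
Qed.

Lemma quadraticZ (a : R) x : I x -> N (a *: x) = a ^+ 2 * N x.
Proof.
move=> Ix; rewrite -polarxx ?polarZl ?polarZr ?polarxx //; first by ring.
all: exact: subspaceZ.
Qed.

Lemma cauchy_schwarz x y : I x -> I y -> polar x y ^+ 2 <= N x * N y.
Proof.
move=> Ix Iy; set p := polar x y.
have key (a b : R) : 0 <= a ^+ 2 * N x + b ^+ 2 * N y + 2 * (a * (b * p)).
  rewrite -!quadraticZ // -polarZr // -polarZl // -?quadraticD; try exact: subspaceZ.
  by apply: N_ge0; apply: subspaceD; exact: subspaceZ.
have [ny0|ny0] := eqVneq (N y) 0.
  have h1 := key p (- (N x + 1)).
  rewrite ny0 in h1; rewrite ny0 mulr0.
  have nx := N_ge0 Ix; have := sqr_ge0 p; nra.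
have ny : 0 < N y by rewrite lt_def ny0 N_ge0.
have := key (N y) (- p).
have -> : N y ^+ 2 * N x + (- p) ^+ 2 * N y + 2 * (N y * (- p * p)) =
    N y * (N x * N y - p ^+ 2) by ring.
by rewrite pmulr_rge0 // subr_ge0.
Qed.

Lemma quadratic_sum_orthogonal n (v : nat -> V) (a : nat -> R) :
  (forall i, (i < n)%N -> I (v i)) ->
  (forall i j, (i < j < n)%N -> polar (v j) (v i) = 0) ->
  N (\sum_(i < n) a i *: v i) = \sum_(i < n) a i ^+ 2 * N (v i).
Proof.
elim: n => [|n IH] hI hO; first by rewrite !big_ord0 quadratic0.
have hI' i : (i < n)%N -> I (v i) by move=> ni; apply: hI; rewrite ltnW.
have hIa i : (i < n)%N -> I (a i *: v i) by move=> /hI' h; exact: subspaceZ.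
have In : I (v n) by exact: hI.
rewrite !big_ord_recr /= addrC quadraticD ?IH //; first last.
- exact: (subspace_sum hIa).
- exact: subspaceZ.
- by move=> i j /andP[ij jn]; apply: hO; rewrite ij ltnW.
rewrite (polar_sumr (F := fun i => a i *: v i)) //; last exact: subspaceZ.
rewrite [X in 2 * X]big1 ?mulr0 ?addr0 => [|i _]; first by rewrite quadraticZ // addrC.
have Ii : I (v i) by exact: hI'.
by rewrite polarZr ?polarZl ?hO ?mulr0 ?ltn_ord ?leqnn //; exact: subspaceZ.
Qed.
End ParallelogramLaw.
End QuadraticForms.

(** * Squares in a vector lattice *)

Section LatticeSquare.
Context {R : realType} {E : banachLatticeType R} (z : E).
Context (ded : dedekind_complete E) (z_ge0 : 0 <=L z).
Implicit Types (x y u v w : E) (l a b c : R).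

Definition dominated x := exists2 c, 0 <= c & labs x <=L c *: z.

Lemma dominated0 : dominated 0.
Proof. by exists 0; rewrite // labs0 scale0r vlexx. Qed.

Lemma dominatedP a x y : dominated x -> dominated y -> dominated (a *: x + y).
Proof.
move=> [c c0 xc] [d d0 yd]; exists (`|a| * c + d); first by rewrite addr_ge0 ?mulr_ge0.
apply: le_vle_trans (labsD _ _) _; rewrite scalerDl vleD // labsZ -scalerA.
exact: vle_scale.
Qed.

Definition tangent x l := (2 * l) *: x - l ^+ 2 *: z.

Lemma tangent_bound x c l : labs x <=L c *: z -> tangent x l <=L c ^+ 2 *: z.
Proof.
move=> xc.
apply: (@le_vle_trans _ _ ((2 * `|l| * c) *: z - l ^+ 2 *: z)).
  rewrite vleD2r; apply: le_vle_trans (vle_labs _) _.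
  rewrite labsZ normrM ger0_norm // -scalerA.
  by apply: vle_scale => //; rewrite mulr_ge0.
rewrite -scalerBl vle_scale2r // -[l ^+ 2]real_normK ?num_real //.
have := sqr_ge0 (`|l| - c); rewrite sqrrB; lra.
Qed.

(** Where [z] is the constant function [1], the value [q x] is the square of
    [x], as the supremum of its tangents. *)
Lemma square_exists : exists q : E -> E, forall x, dominated x ->
  is_lub [set tangent x l | l in [set: R]] (q x).
Proof.
have /choice[q hq] x : exists s, dominated x -> is_lub [set tangent x l | l in [set: R]] s.
  have [[c c0 xc]|h] := pselect (dominated x); last by exists 0.
  have [||s hs] := ded (A := [set tangent x l | l in [set: R]]); last by exists s.
    by exists (tangent x 0), 0.
  by exists (c ^+ 2 *: z) => _ [l _ <-]; exact: tangent_bound.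
by exists q.
Qed.

Context (q : E -> E).
Context (qP : forall x, dominated x -> is_lub [set tangent x l | l in [set: R]] (q x)).

Lemma tangent_le x l : dominated x -> tangent x l <=L q x.
Proof. by move=> /qP[h _]; apply: h; exists l. Qed.

Lemma square_le x w : dominated x -> (forall l, tangent x l <=L w) -> q x <=L w.
Proof. by move=> /qP[_ h] hc; apply: h => _ [l _ <-]. Qed.

Lemma tangent_par x y a b :
  tangent (x + y) (a + b) + tangent (x - y) (a - b) = 2 *: tangent x a + 2 *: tangent y b.
Proof.
rewrite /tangent !scalerDr !scalerN !scalerA.
set X1 := _ *: x; set Y1 := _ *: y; set Z1 := _ *: z.
set X2 := _ *: x; set Y2 := _ *: y; set Z2 := _ *: z.
set X3 := _ *: x; set Z3 := _ *: z; set Y3 := _ *: y; set Z4 := _ *: z.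
have hX : X1 + X2 = X3 by rewrite -scalerDl; congr (_ *: _); ring.
have hY : Y1 - Y2 = Y3 by rewrite -scalerBl; congr (_ *: _); ring.
have hZ : Z1 + Z2 = Z3 + Z4 by rewrite -!scalerDl; congr (_ *: _); ring.
rewrite addrACA [X1 + Y1 + _]addrACA hX hY -opprD hZ opprD.
by rewrite addrACA.
Qed.

(** For tangents, the parallelogram law is the change of parameters
    [l = a + b], [m = a - b]. *)
Lemma square_parallelogram x y : dominated x -> dominated y ->
  q (x + y) + q (x - y) = 2 *: q x + 2 *: q y.
Proof.
move=> Ix Iy.
have Ip : dominated (x + y) by rewrite -[x]scale1r; exact: dominatedP.
have Im : dominated (x - y) by rewrite addrC -scaleN1r; exact: dominatedP.
apply: vle_eq.
  rewrite -vle_subr_addr; apply: square_le => // l.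
  rewrite vle_subr_addr addrC -vle_subr_addr; apply: square_le => // m.
  rewrite vle_subr_addr addrC.
  pose a := (l + m) / 2; pose b := (l - m) / 2.
  have -> : l = a + b by rewrite /a /b; field.
  have -> : m = a - b by rewrite /a /b; field.
  by rewrite tangent_par vleD // vle_scale // tangent_le.
rewrite -scalerDr -(vle_scale2l _ _ (a := 2^-1)) ?invr_gt0 // scalerA.
rewrite mulVf ?pnatr_eq0 // scale1r.
rewrite -vle_subr_addr; apply: square_le => // l.
rewrite vle_subr_addr addrC -vle_subr_addr; apply: square_le => // m.
rewrite vle_subr_addr addrC.
rewrite -(vle_scale2l _ _ (a := 2)) // scalerA mulfV ?pnatr_eq0 // scale1r.
by rewrite scalerDr -tangent_par vleD // tangent_le.
Qed.

Lemma square_ge0 x : dominated x -> 0 <=L q x.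
Proof.
move=> Ix; have := tangent_le 0 Ix.
by rewrite /tangent mulr0 expr0n /= !scale0r subr0.
Qed.

Lemma square_bound x c : 0 <= c -> labs x <=L c *: z -> q x <=L c ^+ 2 *: z.
Proof.
move=> c0 xc; apply: square_le => [|l]; first by exists c.
exact: tangent_bound.
Qed.

Lemma tangent_labs_le x l : dominated x -> 0 <= l ->
  (2 * l) *: labs x - l ^+ 2 *: z <=L q x.
Proof.
move=> Ix l0; rewrite vle_subl_addr -labsZ_ge0 ?mulr_ge0 // labs_le.
rewrite -!vle_subl_addr -!/(tangent _ _) tangent_le //=.
by have := tangent_le (- l) Ix; rewrite /tangent mulrN sqrrN scaleNr.
Qed.

Context (psi : {scalar E}) (psi0 : positive_functional psi).

Definition energy x := psi (q x).

Lemma energy_ge0 x : dominated x -> 0 <= energy x.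
Proof. by move=> Ix; apply: psi0; exact: square_ge0. Qed.

Lemma energy_parallelogram x y : dominated x -> dominated y ->
  energy (x + y) + energy (x - y) = 2 * energy x + 2 * energy y.
Proof.
move=> Ix Iy.
by rewrite /energy -linearD square_parallelogram // linearD !scalarZ.
Qed.

Lemma energy_le x c : 0 <= c -> labs x <=L c *: z -> energy x <= c ^+ 2 * psi z.
Proof.
move=> c0 xc; rewrite -scalarZ.
by apply: functional_mono => //; exact: square_bound.
Qed.

Lemma energy_bounded x y : dominated x -> dominated y ->
  exists K : R, forall t : R, `|t| <= 1 -> energy (t *: x + y) <= K.
Proof.
move=> [c c0 xc] [d d0 yd]; exists ((c + d) ^+ 2 * psi z) => t t1.
apply: energy_le; first exact: addr_ge0.
apply: le_vle_trans (labsD _ _) _; rewrite scalerDl vleD // labsZ.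
apply: le_vle_trans xc; rewrite -[X in _ <=L X]scale1r.
by apply: vle_scale2r => //; exact: labs_ge0.
Qed.

(** The Cauchy-Schwarz inequality, read off from the tangent of slope
    [psi (labs x) / psi z]. *)
Lemma functional_sq_le x : dominated x -> psi (labs x) ^+ 2 <= psi z * energy x.
Proof.
move=> Ix; have [c c0 xc] := Ix.
have key l : 0 <= l -> 2 * l * psi (labs x) - l ^+ 2 * psi z <= energy x.
  move=> l0; rewrite -!scalarZ -linearB.
  by apply: functional_mono => //; exact: tangent_labs_le.
have P0 : 0 <= psi (labs x) by apply: psi0; exact: labs_ge0.
have S0 : 0 <= psi z by exact: psi0.
have PS : psi (labs x) <= c * psi z.
  by rewrite -scalarZ; exact: functional_mono.
move: S0; rewrite le_eqVlt => /orP[/eqP S0|S0].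
  rewrite -S0 mulr0 in PS; have -> : psi (labs x) = 0 by lra.
  by rewrite -S0 mul0r expr0n.
have := key _ (divr_ge0 P0 (ltW S0)).
have -> : 2 * (psi (labs x) / psi z) * psi (labs x) - (psi (labs x) / psi z) ^+ 2 * psi z =
    psi (labs x) ^+ 2 / psi z by field; rewrite gt_eqF.
by rewrite ler_pdivrMr // mulrC.
Qed.
End LatticeSquare.

(** * Compactness of operators dominated by rank one *)

Section RankOneDomination.
Context {R : realType} {E : banachLatticeType R}.
Implicit Types (x y z u w : E) (a b c e : R).

(** A sum of moduli is the supremum of the signed sums; [x] serves the
    induction on [n]. *)
Lemma sum_labs_le (n : nat) (w : nat -> E) y x :
  (forall s : nat -> bool, \sum_(k < n) (-1) ^+ s k *: w k + x <=L y) ->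
  \sum_(k < n) labs (w k) + x <=L y.
Proof.
elim: n x => [|n IH] x h.
  by have := h (fun=> false); rewrite !big_ord0.
rewrite big_ord_recr /= -addrA addrCA -vle_subr_addr labs_le !vle_subr_addr.
apply/andP; split; rewrite addrCA; apply: IH => s.
- have := h (fun k => if k == n then false else s k).
  rewrite big_ord_recr /= eqxx expr0 scale1r addrA.
  congr (_ + _ + _ <=L _); apply: eq_bigr => k _.
  by rewrite ltn_eqF.
- have := h (fun k => if k == n then true else s k).
  rewrite big_ord_recr /= eqxx expr1 scaleN1r addrA.
  congr (_ + _ + _ <=L _); apply: eq_bigr => k _.
  by rewrite ltn_eqF.
Qed.

(** An operator [U] with [U x <= psi x *: y] for [x >= 0] maps order intervals
    to relatively compact sets, here in the form of an approximation by finite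
    combinations with bounded coefficients. Gram-Schmidt for the energy form
    of [z] would otherwise yield arbitrarily many orthogonal vectors [v k] with
    [phi (labs (U (v k))) > e].  Orthogonality bounds all their signed sums by
    a multiple of the square root of their number, whereas the supremum of
    the images of these sums is the sum of the moduli. *)
Lemma rank_one_dominated_approx (U : {linear E -> E}) (psi phi : {scalar E}) y z e :
  dedekind_complete E -> positive_operator U -> positive_functional psi ->
  positive_functional phi -> 0 <=L y -> 0 <=L z ->
  (forall x, 0 <=L x -> U x <=L psi x *: y) -> 0 < e ->
  exists K (u : nat -> E) (M : R), forall x, labs x <=L z ->
    exists2 a : nat -> R, (forall k, `|a k| <= M) &
      phi (labs (U (x - \sum_(k < K) a k *: u k))) <= e.
Proof.
move=> ded U0 psi0 phi0 y0 z0 Uy e0; apply: contrapT => nh.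
have [q qP] := square_exists ded z0.
pose I := dominated z; pose N := energy q psi; pose B := polar N.
have I0 : I 0 := dominated0 z.
have IP : forall (a : R) x y, I x -> I y -> I (a *: x + y) := fun a x y => @dominatedP R E z a x y.
have Nge : forall x, I x -> 0 <= N x by move=> x Ix; exact: (energy_ge0 qP psi0 Ix).
have Npar : forall x y, I x -> I y -> N (x + y) + N (x - y) = 2 * N x + 2 * N y.
  by move=> x x' Ix Ix'; exact: (energy_parallelogram qP psi).
have Nbd : forall x y, I x -> I y ->
    exists K : R, forall t : R, `|t| <= 1 -> N (t *: x + y) <= K.
  by move=> x x' Ix Ix'; exact: (energy_bounded z0 qP psi0).
pose c := psi z.
have c0 : 0 <= c by exact: psi0.
have Nc x : labs x <=L z -> N x <= c.
  move=> xz; rewrite -[leRHS]mul1r -[X in X * _](expr1n _ 2).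
  by apply: (energy_le z0 qP psi0); rewrite // scale1r.
have Iz x : labs x <=L z -> I x by exists 1; rewrite ?scale1r.
have UN x : I x -> N x = 0 -> U x = 0.
  move=> Ix Nx; have := functional_sq_le z0 qP psi0 Ix.
  rewrite -/(N x) Nx mulr0 => h.
  have p0 : psi (labs x) = 0.
    by apply/eqP; rewrite -sqrf_eq0 eq_le h sqr_ge0.
  apply: labs_eq0; apply: vle_eq; last exact: labs_ge0.
  apply: le_vle_trans (positive_labs U0 x) _.
  by have := Uy _ (labs_ge0 x); rewrite p0 scale0r.
have greedy K : exists v : nat -> E, (forall k, (k < K)%N -> [/\ I (v k), N (v k) <= c &
      e < phi (labs (U (v k)))]) /\
    forall i j, (i < j < K)%N -> B (v j) (v i) = 0.
  elim: K => [|K [v [hv ho]]]; first by exists (fun=> 0); split=> // i j; rewrite andbF.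
  have Iv i : (i < K)%N -> I (v i) by case/hv.
  have Nv i : (i < K)%N -> 0 < N (v i).
    move=> iK; have [Ii _ ei] := hv i iK; rewrite lt_def Nge // andbT.
    apply/negP => /eqP /(UN _ Ii) Ui; move: ei; rewrite Ui labs0 linear0.
    by rewrite ltNge ltW.
  pose M := \sum_(k < K) (c / N (v k) + 1).
  apply: contrapT => nv; apply: nh; exists K, v, M => x xz.
  have Ix := Iz x xz.
  pose a k := if (k < K)%N then B x (v k) / N (v k) else 0.
  have term0 (k : 'I_K) : 0 <= c / N (v k) + 1.
    by rewrite addr_ge0 // divr_ge0 // ltW // Nv.
  exists a => [k|].
    rewrite /a; case: ifP => kK; last by rewrite normr0 sumr_ge0.
    apply: (@le_trans _ _ (c / N (v k) + 1)); last first.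
      by rewrite /M (bigD1 (Ordinal kK)) //= lerDl sumr_ge0.
    have nk := Nv k kK.
    have cs : (B x (v k) / N (v k)) ^+ 2 <= c / N (v k).
      rewrite expr_div_n ler_pdivrMr ?exprn_gt0 // [N (v k) ^+ 2]expr2 mulrA divfK ?gt_eqF //.
      apply: le_trans (cauchy_schwarz I0 IP Nge Npar Nbd Ix (Iv _ kK)) _.
      by rewrite ler_pM2r // Nc.
    set b := B x (v k) / N (v k) in cs *.
    have : `|b| <= b ^+ 2 + 1.
      rewrite -[b ^+ 2]real_normK ?num_real //.
      have := sqr_ge0 (`|b| - 1); rewrite sqrrB1; have := normr_ge0 b; lra.
    lra.
  rewrite leNgt; apply/negP => ef; apply: nv.
  set f := \sum_(k < K) _ in ef.
  have Ia i : (i < K)%N -> I (a i *: v i).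
    by move=> iK; apply: (subspaceZ I0 IP); exact: Iv.
  have If : I f by exact: (subspace_sum I0 IP Ia).
  have Ixf : I (x - f) by exact: (subspaceB I0 IP).
  have orth i : (i < K)%N -> B (x - f) (v i) = 0.
    move=> iK; have Ii := Iv i iK.
    have vv k : (k < K)%N -> k != i -> B (v i) (v k) = 0.
      move=> kK; rewrite neq_ltn => /orP[ki|ik].
        by apply: ho; rewrite ki.
      have Ik := Iv k kK.
      by rewrite /B (polarC I0 IP Npar) //; apply: ho; rewrite ik.
    rewrite /B (polarC I0 IP Npar) // -scaleN1r.
    rewrite (polarDr I0 IP Npar) //; last exact: (subspaceZ I0 IP).
    rewrite (polarZr I0 IP Nge Npar Nbd) // (polar_sumr I0 IP Nge Npar Nbd (F := fun k => a k *: v k)) //.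
    rewrite (bigD1 (Ordinal iK)) //= big1 => [|k ki]; last first.
      rewrite (polarZr I0 IP Nge Npar Nbd) //; last exact: Iv.
      by rewrite -/B vv ?mulr0.
    rewrite (polarZr I0 IP Nge Npar Nbd) // (polarxx I0 Npar) // /a iK.
    rewrite divfK; last by rewrite gt_eqF ?Nv.
    by rewrite (polarC I0 IP Npar) // addr0 mulN1r subrr.
  exists (fun k => if k == K then x - f else v k); split.
    move=> k; rewrite ltnS leq_eqVlt; case: eqP => [_ _|_ /= /hv //].
    split=> //; apply: le_trans (Nc x xz).
    rewrite -[X in _ <= N X](subrK f x) [leRHS](quadraticD Npar) //.
    rewrite (polar_sumr I0 IP Nge Npar Nbd (F := fun k => a k *: v k)) //.
    rewrite [X in 2 * X]big1 => [|i _]; last first.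
      have Ii := Iv i (ltn_ord i); have oi := orth i (ltn_ord i).
      by rewrite (polarZr I0 IP Nge Npar Nbd) // [polar _ _ _]oi mulr0.
    by rewrite mulr0 addr0 lerDl Nge.
  move=> i j /andP[ij]; rewrite ltnS leq_eqVlt => /orP[/eqP jK|jK].
    by rewrite jK eqxx ltn_eqF -?jK // orth // -jK.
  by rewrite !ltn_eqF ?ho ?ij // (ltn_trans ij).
(* [m ^ 2] orthogonal vectors would give [m ^ 2 * e <= m * c * phi y] *)
pose m := (Num.bound (c * phi y / e)).+1.
have m0 : 0 < m%:R :> R by rewrite ltr0n.
have hm : c * phi y < m%:R * e.
  rewrite -ltr_pdivrMr //.
  apply: lt_trans (archi_boundP _) _; last by rewrite ltr_nat.
  by rewrite divr_ge0 ?mulr_ge0 ?phi0 // ltW.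
have [v [hv ho]] := greedy (m ^ 2)%N.
have Iv i : (i < m ^ 2)%N -> I (v i) by case/hv.
have signed (s : nat -> bool) :
    \sum_(k < m ^ 2) (-1) ^+ s k *: U (v k) + 0 <=L (m%:R * c) *: y.
  set w := \sum_(k < m ^ 2) (-1) ^+ s k *: v k.
  have -> : \sum_(k < m ^ 2) (-1) ^+ s k *: U (v k) = U w.
    by rewrite linear_sum; apply: eq_bigr => k _; rewrite linearZ.
  rewrite addr0; have Iw : I w.
    apply: (subspace_sum I0 IP (F := fun k => (-1) ^+ s k *: v k)) => k km.
    by apply: (subspaceZ I0 IP); exact: Iv.
  have Nw : N w <= (m ^ 2)%:R * c.
    rewrite /w (quadratic_sum_orthogonal I0 IP Nge Npar Nbd (fun k => (-1) ^+ s k)) //.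
    rewrite mulr_natl -[leRHS](_ : \sum_(k < m ^ 2) c = _); last first.
      by rewrite sumr_const card_ord.
    by apply: ler_sum => k _; rewrite sqrr_sign mul1r; have [] := hv k (ltn_ord k).
  have pw : psi (labs w) <= m%:R * c.
    rewrite -ler_sqr ?nnegrE ?mulr_ge0 ?psi0 ?labs_ge0 //.
    apply: le_trans (functional_sq_le z0 qP psi0 Iw) _.
    have -> : (m%:R * c) ^+ 2 = c * ((m ^ 2)%:R * c) by rewrite natrX; ring.
    exact: ler_wpM2l.
  apply: le_vle_trans (vle_labs _) _; apply: le_vle_trans (positive_labs U0 _) _.
  apply: le_vle_trans (Uy _ (labs_ge0 _)) _; exact: vle_scale2r.
have := functional_mono phi0 (sum_labs_le (w := U \o v) signed).
rewrite addr0 linear_sum scalarZ => h.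
have : (m ^ 2)%:R * e <= m%:R * c * phi y.
  apply: le_trans h; rewrite mulr_natl -[leLHS](_ : \sum_(k < m ^ 2) e = _).
    by apply: ler_sum => k _; have [_ _ /ltW] := hv k (ltn_ord k).
  by rewrite sumr_const card_ord.
rewrite natrX expr2 -!mulrA ler_pM2l // leNgt; exact/negP/negPn.
Qed.
End RankOneDomination.

(** * Overlap of the operators at nearby times *)

Section Partitions.
Context {R : realType} {E : banachLatticeType R}.
Implicit Types (x y z u v : E) (s : seq E) (A W : {linear E -> E}).

Let nonneg s := all (fun a => 0 <=L a) s.
Let total s : E := \sum_(a <- s) a.
Let variation A s : E := \sum_(a <- s) vpos (A a).

(** Riesz decomposition cuts every piece of the partition [s] along [z]. *)
Lemma partition_split A s z : nonneg s -> 0 <=L z -> z <=L total s ->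
  exists s', [/\ nonneg s', total s' = total s, variation A s <=L variation A s' &
    A z <=L variation A s'].
Proof.
rewrite /total /variation; elim: s z => [|a s IH] z /=.
  rewrite big_nil => _ z0 z1; exists [::]; split=> //; rewrite !big_nil ?vlexx //.
  by rewrite (vle_eq z1 z0) linear0 vlexx.
move=> /andP[a0 s0] z0; rewrite big_cons => zas.
have t0 : 0 <=L \sum_(b <- s) b.
  rewrite big_seq; apply: vsumr_ge0 => b bs; exact: (allP s0).
have [u [v [zE u0 ua v0 vs]]] := riesz_decomposition a0 t0 z0 zas.
have [s' [s'0 s't s's s'v]] := IH v s0 v0 vs.
exists [:: u, a - u & s']; rewrite !big_cons; split=> /=.
- by rewrite u0 vsubr_ge0 ua.
- by rewrite s't addrA [u + _]addrC subrK.
- rewrite addrA vleD // vjoin_le vaddr_ge0 ?vpos_ge0 // andbT.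
  by rewrite -{1}(subrK u a) linearD addrC vleD ?vle_vpos.
rewrite zE linearD vleD ?vle_vpos //; apply: le_vle_trans s'v _.
by rewrite vleDr // vpos_ge0.
Qed.

(** The sums [variation A s] increase under refinement, and refining a
    partition often enough makes them exceed any finite join of values of [A] on
    [[0, x]]. *)
Lemma join_closure_partition A x j : join_closure (interval_image A x) j ->
  forall s, nonneg s -> total s = x ->
  exists s', [/\ nonneg s', total s' = x, variation A s <=L variation A s' &
    j <=L variation A s'].
Proof.
elim=> [_ [z [z0 zx] <-] s s0 sx|j1 j2 _ IH1 _ IH2 s s0 sx].
  by rewrite -sx in zx *; exact: partition_split.
have [s1 [s10 s1x v1 h1]] := IH1 s s0 sx.
have [s2 [s20 s2x v2 h2]] := IH2 s1 s10 s1x.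
exists s2; split=> //; first exact: le_vle_trans v2.
by apply: vjoin_lub => //; exact: le_vle_trans v2.
Qed.

(** The supremum [W x] is approximated in norm by finite joins, which are
    dominated by sums over partitions. *)
Lemma positive_part_estimate A W (phi : {scalar E}) x (b : R) :
  order_continuous_norm E -> positive_functional phi -> bounded_functional phi ->
  0 <=L x -> is_lub (interval_image A x) (W x) ->
  (forall s, all (fun a => 0 <=L a) s -> \sum_(a <- s) a = x ->
     \sum_(a <- s) phi (vpos (A a)) <= b) ->
  phi (W x) <= b.
Proof.
move=> oc phi0 phib x0 lubW hb.
have [C C0 hC] := bounded_functional_pos phib.
have A0 : interval_image A x !=set0 by exists (A 0), 0; split; rewrite ?vlexx.
have [w [lubw approx]] := lub_approx oc A0 (proj1 lubW).
rewrite (is_lub_unique lubW lubw); apply/ler_addgt0Pr => e e0.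
have [j jc wj] := approx (e / C) (divr_gt0 e0 C0).
have [||s [s0 sx _ js]] := join_closure_partition jc (s := [:: x]).
- by rewrite /nonneg /= x0.
- exact: big_seq1.
have h1 : phi (w - j) <= e.
  apply: le_trans (ler_norm _) _; apply: le_trans (hC _) _.
  by move: wj; rewrite ltr_pdivlMr // mulrC => /ltW.
rewrite -(subrK j w) linearD addrC lerD //.
apply: le_trans (functional_mono phi0 js) _.
by rewrite linear_sum hb.
Qed.
End Partitions.

Section Overlap.
Context {R : realType} {E : banachLatticeType R} (T : R -> {linear E -> E}).
Context (oc : order_continuous_norm E)
  (scT : strongly_continuous_semigroup T) (posT : positive_semigroup T)
  (bddT : bounded_semigroup T) (irrT : irreducible_semigroup T).
Context (phi : {scalar E}) (h : E) (sp : strictly_positive phi)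
  (phib : bounded_functional phi)
  (phiT : forall t, 0 <= t -> forall x, phi (T t x) = phi x)
  (Fh : Fix T h) (h0 : 0 <=L h) (phih : phi h = 1).
Implicit Types (x y z u v : E) (t s a b e r : R).

Lemma common_radius (P : nat -> R -> Prop) :
  (forall k, exists2 r, 0 < r & forall s, 0 <= s -> s < r -> P k s) ->
  forall n, exists2 r, 0 < r & forall s, 0 <= s -> s < r -> forall k, (k < n)%N -> P k s.
Proof.
move=> hP; elim=> [|n [r r0 hr]]; first by exists 1.
have [r' r'0 hr'] := hP n; exists (Num.min r r'); first by rewrite lt_min r0.
move=> s s0; rewrite lt_min => /andP[sr sr'] k; rewrite ltnS leq_eqVlt.
by move=> /orP[/eqP->|]; [exact: hr' | exact: hr].
Qed.

Lemma phi_labs_invariant t x : 0 <= t -> phi (labs (T t x)) <= phi (labs x).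
Proof.
move=> t0; rewrite -(phiT t0 (labs x)); apply: functional_mono; first by case: sp.
exact: positive_labs (posT t0) _.
Qed.

(** On the finitely many vectors that approximate the images of the interval,
    [T s] tends to the identity uniformly. *)
Lemma rank_one_dominated_continuity (U : {linear E -> E}) (psi : {scalar E}) y z e :
  positive_operator U -> positive_functional psi -> 0 <=L y -> 0 <=L z ->
  (forall x, 0 <=L x -> U x <=L psi x *: y) -> 0 < e ->
  exists2 r, 0 < r & forall s, 0 <= s -> s < r -> forall x, labs x <=L z ->
    phi (labs (T s (U x) - U x)) <= e.
Proof.
move=> U0 psi0 y0 z0 Uy e0; have phi0 : positive_functional phi by case: sp.
have [K [u [M hM]]] := rank_one_dominated_approx (order_continuous_dedekind oc)
  U0 psi0 phi0 y0 z0 Uy (divr_gt0 e0 (ltr0n R 4)).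
have [C C0 hC] := bounded_functional_pos phib.
pose D := C * (`|M| * K%:R) + 1.
have D0 : 0 < D by rewrite ltr_wpDl // mulr_ge0 ?(ltW C0) // mulr_ge0.
have d0 : 0 < e / 2 / D by rewrite !divr_gt0.
have [r r0 hr] := common_radius
  (fun k => semigroup_right_continuous scT (U (u k)) d0) K.
exists r => // s s0 sr x xz; have [a aM ha] := hM x xz.
set f := \sum_(k < K) _ in ha.
have fE : T s (U f) - U f = \sum_(k < K) a k *: (T s (U (u k)) - U (u k)).
  rewrite /f linear_sum linear_sum -sumrB; apply: eq_bigr => k _.
  by rewrite [U (_ *: _)]linearZ [T s (_ *: _)]linearZ -scalerBr.
have part1 : phi (labs (T s (U f) - U f)) <= e / 2.
  rewrite fE; apply: le_trans (functional_mono phi0 (labs_sum _ _)) _.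
  rewrite linear_sum; apply: (@le_trans _ _ (\sum_(k < K) `|M| * (C * (e / 2 / D)))).
    apply: ler_sum => k _; rewrite labsZ scalarZ.
    apply: ler_pM => //; first by rewrite phi0 // labs_ge0.
      by apply: le_trans (aM k) (ler_norm M).
    apply: le_trans (ler_norm _) _; apply: le_trans (hC _) _.
    by rewrite norm_labs ler_pM2l // ltW // hr.
  rewrite sumr_const card_ord -[_ *+ K]mulr_natr.
  have -> : `|M| * (C * (e / 2 / D)) * K%:R = e / 2 * ((D - 1) / D).
    by rewrite /D addrK; field; rewrite gt_eqF.
  rewrite ler_piMr ?divr_ge0 ?(ltW e0) // ler_pdivrMr // mul1r; lra.
have -> : T s (U x) - U x = (T s (U (x - f)) - U (x - f)) + (T s (U f) - U f).
  rewrite -{1 2}(subrK f x) ![U (_ + f)]linearD [T s (_ + _)]linearD.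
  by rewrite opprD addrACA.
apply: le_trans (functional_mono phi0 (labsD _ _)) _; rewrite linearD.
have part2 : phi (labs (T s (U (x - f)) - U (x - f))) <= e / 4 + e / 4.
  apply: le_trans (functional_mono phi0 (labsB _ _)) _; rewrite linearD.
  apply: lerD => //; apply: le_trans ha; exact: phi_labs_invariant.
lra.
Qed.

(** For [U2 = U T(b) U] and [x >= 0], the vector [U2 x] is [psi x] times an
    element of the image under [U] of the interval [[0, T b y]].  By the previous
    lemma and a summation over partitions of [h], the positive part of
    [U2 - T s U2] is small at [h] when [s] is small.  The operator [Q] is
    [U2] minus this positive part, that is, the infimum of [U2] and [T s U2]. *)
Lemma overlap (U : {linear E -> E}) (psi : {scalar E}) y t1 :
  0 <= t1 -> positive_operator U -> op_le U (T t1) -> positive_functional psi ->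
  0 <=L y -> (forall x, 0 <=L x -> U x <=L psi x *: y) ->
  (exists2 x, 0 <=L x & U x != 0) ->
  exists c, 0 <= c /\ exists2 r, 0 < r & forall s, 0 < s -> s < r ->
    exists Q : {linear E -> E}, [/\ positive_operator Q, op_le Q (T c),
      op_le Q (T (c + s)) & 0 < phi (Q h)].
Proof.
move=> t10 U0 UT psi0 y0 Uy [x0 x00 Ux0].
have phi0 : positive_functional phi by case: sp.
have Ub : bounded_operator U.
  by apply: (bounded_operator_le U0 UT); have [+ _ _ _] := scT; exact.
have [w wE] : exists w : {scalar E}, (w : E -> R) = phi \o U.
  by apply: scalar_exists => a x x' /=; rewrite !linearP.
have w0 : positive_functional w by move=> x xp; rewrite wE; apply: phi0; exact: U0.
have wb : bounded_functional w by rewrite wE; exact: bounded_functional_comp.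
have wn : exists x, w x != 0.
  exists x0; rewrite wE gt_eqF //; apply: (strictly_positive_pos sp) => //; exact: U0.
have hn : h != 0.
  by apply/eqP => hE; have := oner_neq0 R; rewrite -phih hE linear0 eqxx.
have [b1 b10] := irreducible_functional scT posT bddT irrT w0 wb wn h0 hn.
rewrite Fh // => wh.
have Uh0 : U h != 0 by apply/eqP => Uh; move: wh; rewrite wE /= Uh linear0 ltxx.
have [b b0 hb] := irreducible_functional scT posT bddT irrT w0 wb wn (U0 _ h0) Uh0.
have [U2 U2E] : exists U2 : {linear E -> E}, (U2 : E -> E) = fun x => U (T b (U x)).
  by apply: linear_exists => a x x'; rewrite !linearP.
have U20 : positive_operator U2.
  by move=> x xp; rewrite U2E; apply: (U0 _); apply: posT => //; exact: U0.
have hU2 : 0 < phi (U2 h) by rewrite U2E; move: hb; rewrite wE.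
pose c := t1 + (b + t1).
have c0 : 0 <= c by rewrite !addr_ge0.
have U2c : op_le U2 (T c).
  move=> x xp; rewrite U2E /c semigroupD ?addr_ge0 //.
  apply: (@le_vle_trans _ _ (T t1 (T b (U x)))).
    by apply: UT; apply: posT => //; exact: U0.
  apply: (positive_mono (posT t10)). rewrite (semigroupD scT) //.
  by apply: (positive_mono (posT b0)); exact: UT.
pose e := phi (U2 h) / (psi h + 1).
have ph1 : 0 < psi h + 1 by rewrite ltr_wpDl // psi0.
have e0 : 0 < e by rewrite divr_gt0.
have z0 : 0 <=L T b y by exact: posT.
have [r r0 hr] := rank_one_dominated_continuity U0 psi0 y0 z0 Uy e0.
exists c; split=> //; exists r => // s s0 sr; have s0' := ltW s0.
have [A AE] : exists A : {linear E -> E}, (A : E -> E) = fun x => U2 x - T s (U2 x).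
  apply: linear_exists => a x x'; rewrite (linearP U2) (linearP (T s)) scalerBr.
  by rewrite opprD addrACA.
have AU2 : op_le A U2.
  by move=> x xp; rewrite AE vle_subl_addr vleDl // posT // U20.
have [W [W0 AW lubW Wmin]] :=
  positive_part_operator (order_continuous_dedekind oc) U20 AU2.
have Wh : phi (W h) <= e * psi h.
  apply: (positive_part_estimate oc phi0 phib h0 (lubW h h0)) => q q0 qh.
  rewrite -qh linear_sum mulr_sumr big_seq [leRHS]big_seq.
  apply: ler_sum => a aq; have a0 : 0 <=L a := allP q0 _ aq.
  have := psi0 a a0; rewrite le_eqVlt => /orP[/eqP pa|pa].
    have Ua : U a = 0.
      apply: vle_eq; last exact: U0.
      by have := Uy a a0; rewrite -pa scale0r.
    by rewrite AE U2E Ua !linear0 addr0 vpos_id ?vlexx // linear0 -pa mulr0.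
  pose x := T b ((psi a)^-1 *: U a).
  have xz : labs x <=L T b y.
    rewrite labs_id; last first.
      by apply: posT => //; rewrite vscale_ge0 ?U0 // invr_ge0 ltW.
    apply: (positive_mono (posT b0)).
    rewrite -(vle_scale2l _ _ pa) scalerA mulfV ?gt_eqF // scale1r; exact: Uy.
  have U2a : U2 a = psi a *: U x.
    by rewrite U2E /x [T b (_ *: _)]linearZ [U (_ *: _)]linearZ scalerA mulfV ?gt_eqF // scale1r.
  rewrite AE U2a linearZ -scalerBr vposZ // scalarZ mulrC ler_pM2r //.
  apply: le_trans (hr s s0' sr x xz); apply: functional_mono => //.
  by rewrite labs_subC vpos_le_labs.
have [Q QE] : exists Q : {linear E -> E}, (Q : E -> E) = fun x => U2 x - W x.
  apply: linear_exists => a x x'; rewrite (linearP U2) (linearP W) scalerBr.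
  by rewrite opprD addrACA.
exists Q; split.
- by move=> x xp; rewrite QE vsubr_ge0 Wmin // => v v0; exact: vlexx.
- move=> x xp; rewrite QE; apply: le_vle_trans (U2c x xp).
  by rewrite vle_subl_addr vleDl // W0.
- move=> x xp; rewrite addrC (semigroupD scT) // QE.
  apply: (@le_vle_trans _ _ (T s (U2 x))); last first.
    by apply: (positive_mono (posT s0')); exact: U2c.
  rewrite vle_subl_addr addrC -vle_subl_addr.
  by have := AW x xp; rewrite AE.
rewrite QE linearB subr_gt0; apply: le_lt_trans Wh _.
by rewrite /e mulrAC ltr_pdivrMr // ltr_pM2l // ltrDl.
Qed.
End Overlap.

(** * Binomial means *)

Section RandomWalk.
Context {R : realType}.

(** Expectation of [f] under the binomial distribution with parameters [n]
    and [1/2]. *)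
Fixpoint binomial_mean {V : lmodType R} (n : nat) (f : nat -> V) : V :=
  if n is n'.+1 then 2^-1 *: (binomial_mean n' f + binomial_mean n' (f \o succn))
  else f 0%N.

Lemma half_double (V : lmodType R) (x : V) : 2 *: (2^-1 *: x) = x.
Proof. by rewrite scalerA mulfV ?pnatr_eq0 // scale1r. Qed.

Lemma half_sum (V : lmodType R) (x : V) : 2^-1 *: (x + x) = x.
Proof. by rewrite -[x + x]mulr2n -[x *+ 2]scaler_nat scalerA mulVf ?pnatr_eq0 // scale1r. Qed.

Lemma binomial_meanP (V : lmodType R) n (a : R) (f g : nat -> V) :
  binomial_mean n (fun j => a *: f j + g j) =
  a *: binomial_mean n f + binomial_mean n g.
Proof.
elim: n f g => [//|n IH] f g /=.
rewrite IH (IH (f \o succn) (g \o succn)) !scalerDr !scalerA [a * _]mulrC.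
by rewrite addrACA.
Qed.

Lemma binomial_meanD (V : lmodType R) n (f g : nat -> V) :
  binomial_mean n (fun j => f j + g j) = binomial_mean n f + binomial_mean n g.
Proof.
rewrite -[binomial_mean n f]scale1r -binomial_meanP; congr binomial_mean.
by apply/funext => j; rewrite scale1r.
Qed.

Lemma binomial_meanB (V : lmodType R) n (f g : nat -> V) :
  binomial_mean n (fun j => f j - g j) = binomial_mean n f - binomial_mean n g.
Proof.
rewrite addrC -scaleN1r -binomial_meanP; congr binomial_mean.
by apply/funext => j; rewrite scaleN1r addrC.
Qed.

(** Stein's identity for the binomial distribution. *)
Lemma binomial_stein (V : lmodType R) k (a : nat -> V) :
  2 *: binomial_mean k.+1 (fun j => (k.+1%:R - 2 * j%:R) *: a j) =
  k.+1%:R *: binomial_mean k (fun j => a j - a j.+1).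
Proof.
pose L n (b : nat -> V) := binomial_mean n (fun j => (n%:R - 2 * j%:R) *: b j).
have LS n b : 2 *: L n.+1 b = L n b + L n (b \o succn) + binomial_mean n (fun j => b j - b j.+1).
  rewrite /L /= half_double.
  have -> : (fun j => (n.+1%:R - 2 * j%:R) *: b j) = fun j => (n%:R - 2 * j%:R) *: b j + b j.
    by apply/funext => j; rewrite -[n.+1%:R]natr1 addrAC scalerDl scale1r.
  have -> : (fun j => (n%:R - 2 * j%:R) *: b j + b j) \o succn =
      fun j => (n%:R - 2 * j%:R) *: b j.+1 - b j.+1.
    apply/funext => j /=.
    have -> : n%:R - 2 * j.+1%:R = n%:R - 2 * j%:R - 1 - 1 :> R.
      by rewrite -[j.+1%:R]natr1; ring.
    by rewrite scalerBl scale1r subrK scalerBl scale1r.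
  by rewrite (binomial_meanD n _ b) !binomial_meanB addrACA.
pose D n (b : nat -> V) := binomial_mean n (fun j => b j - b j.+1).
rewrite -/(L k.+1 a) -/(D k a); elim: k a => [|k IH] a.
  by rewrite LS /L /= mulr0 subrr !scale0r !add0r scale1r.
rewrite LS -/(D k.+1 a) -[L k.+1 a](scalerK (a := 2)) ?unitfE ?pnatr_eq0 // IH.
rewrite -[L k.+1 _](scalerK (a := 2)) ?unitfE ?pnatr_eq0 // IH.
rewrite -scalerDr -scalerDr scalerA mulrC -scalerA.
by rewrite -[k.+2%:R]natr1 scalerDl scale1r.
Qed.

Lemma binomial_mean_const (V : lmodType R) n (v : V) : binomial_mean n (fun=> v) = v.
Proof.
elim: n => [//|n IH] /=.
by rewrite (_ : (fun=> v) \o succn = fun=> v) // IH half_sum.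
Qed.

Lemma binomial_variance n :
  binomial_mean n (fun j => (n%:R - 2 * j%:R) ^+ 2 : R) = n%:R.
Proof.
elim: n => [|n IH] /=; first by rewrite mulr0 subrr expr0n.
pose s j : R := (n%:R - 2 * j%:R) ^+ 2; pose f j : R := n%:R - 2 * j%:R.
have -> : (fun j => (n.+1%:R - 2 * j%:R) ^+ 2 : R) =
    fun j => s j + ((2 : R) *: f j + 1).
  apply/funext => j; have -> : n.+1%:R = n%:R + 1 :> R by rewrite natr1.
  by rewrite /s /f -[_ *: _]/(2 * _); ring.
have -> : (fun j => s j + ((2 : R) *: f j + 1)) \o succn =
    fun j => s j - ((2 : R) *: f j - 1).
  apply/funext => j /=; have e1 : j.+1%:R = j%:R + 1 :> R by rewrite natr1.
  by rewrite /s /f e1 -![_ *: _]/(2 * _); ring.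
rewrite binomial_meanD binomial_meanB !binomial_meanD !binomial_mean_const.
have -> : binomial_mean n s = n%:R := IH.
set B : R := binomial_mean n (fun j => 2 *: f j).
rewrite -[_ *: _]/(2^-1 * _) -[n.+1%:R]natr1; lra.
Qed.

Lemma binomial_mean_labs (E : banachLatticeType R) (h : E) n (r : nat -> R) (f : nat -> E) :
  (forall j, labs (f j) <=L r j *: h) ->
  labs (binomial_mean n f) <=L (binomial_mean n r : R) *: h.
Proof.
elim: n f r => [|n IH] f r hf /=; first exact: hf.
rewrite labsZ_ge0 ?invr_ge0 // -[_ *: (_ + _ : R)]/(2^-1 * _) -scalerA.
apply: vle_scale; first by rewrite invr_ge0.
apply: le_vle_trans (labsD _ _) _; rewrite scalerDl; apply: vleD; first exact: IH.
by apply: IH => j; exact: hf.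
Qed.

Lemma binomial_mean_le n (r s : nat -> R) : (forall j, r j <= s j :> R) ->
  (binomial_mean n r : R) <= binomial_mean n s.
Proof.
elim: n r s => [|n IH] r s hrs /=; first exact: hrs.
rewrite -![_ *: (_ + _ : R)]/(2^-1 * _) ler_pM2l ?invr_gt0 //.
by rewrite lerD // IH // => j; exact: hrs.
Qed.

(** The differences of consecutive terms have small means, of the order of the
    inverse of the standard deviation. *)
Lemma binomial_mean_difference (E : banachLatticeType R) (h : E) (a : nat -> E) m k :
  0 <=L h -> (0 < m)%N -> k.+1 = (m ^ 2)%N -> (forall j, labs (a j) <=L h) ->
  labs (binomial_mean k (fun j => a j - a j.+1)) <=L (2 / m%:R) *: h.
Proof.
move=> h0 m0 km ah; have mR : 0 < m%:R :> R by rewrite ltr0n.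
have kR : k.+1%:R = m%:R ^+ 2 :> R by rewrite km natrX.
have kR0 : 0 < k.+1%:R :> R by rewrite ltr0n.
rewrite -(vle_scale2l _ _ kR0) -labsZ_ge0 ?(ltW kR0) // -binomial_stein.
rewrite labsZ_ge0 // scalerA.
pose r j : R := `|k.+1%:R - 2 * j%:R : R|.
apply: (@le_vle_trans _ _ ((2 * (binomial_mean k.+1 r : R)) *: h)).
  rewrite -scalerA; apply: vle_scale => //; apply: binomial_mean_labs => j.
  by rewrite labsZ; exact: vle_scale.
apply: vle_scale2r => //.
have -> : k.+1%:R * (2 / m%:R) = 2 * m%:R :> R.
  by rewrite kR; field; rewrite gt_eqF.
rewrite ler_pM2l //.
(* the arithmetic-geometric mean inequality at the scale [m] of the standard
   deviation *)
pose c : R := (2 * m%:R)^-1.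
have c0 : 0 < c by rewrite invr_gt0 mulr_gt0.
pose s j : R := c *: ((k.+1%:R - 2 * j%:R) ^+ 2 : R) + m%:R / 2.
apply: (@le_trans _ _ (binomial_mean k.+1 s)).
  apply: binomial_mean_le => j; rewrite /r /s -[_ *: _]/(c * _).
  set u := k.+1%:R - 2 * j%:R; rewrite -[u ^+ 2]real_normK ?num_real //.
  rewrite -subr_ge0.
  have -> : c * `|u| ^+ 2 + m%:R / 2 - `|u| = c * (`|u| - m%:R) ^+ 2.
    by rewrite /c; field; rewrite gt_eqF.
  by rewrite mulr_ge0 ?sqr_ge0 // ltW.
rewrite /s binomial_meanP binomial_mean_const binomial_variance kR -[_ *: _]/(c * _).
have -> : c * m%:R ^+ 2 = m%:R / 2 by rewrite /c; field; rewrite gt_eqF.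
lra.
Qed.
End RandomWalk.

(** * Asymptotic invariance under small translations *)

Section AsymptoticInvariance.
Context {R : realType} {E : banachLatticeType R} (T : R -> {linear E -> E}).
Context (oc : order_continuous_norm E)
  (scT : strongly_continuous_semigroup T) (posT : positive_semigroup T)
  (bddT : bounded_semigroup T) (irrT : irreducible_semigroup T).
Context (phi : {scalar E}) (h : E) (sp : strictly_positive phi)
  (phib : bounded_functional phi)
  (phiT : forall t, 0 <= t -> forall x, phi (T t x) = phi x)
  (Fh : Fix T h) (h0 : 0 <=L h) (phih : phi h = 1).
Implicit Types (x y z u v : E) (t s a b e r : R).

Definition vanishes x : Prop :=
  forall e, 0 < e -> exists2 t0, 0 <= t0 & forall t, t0 <= t -> `|T t x| <= e.

Lemma vanishesD x y : vanishes x -> vanishes y -> vanishes (x + y).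
Proof.
move=> hx hy e e0.
have [t1 t10 h1] := hx _ (divr_gt0 e0 (ltr0n R 2)).
have [t2 t20 h2] := hy _ (divr_gt0 e0 (ltr0n R 2)).
exists (Num.max t1 t2) => [|t]; first by rewrite le_max t10.
rewrite ge_max => /andP[/h1 tx /h2 ty].
by rewrite linearD (splitr e) (le_trans (ler_normD _ _)) ?lerD.
Qed.

Lemma vanishesZ a x : vanishes x -> vanishes (a *: x).
Proof.
move=> hx e e0; have a0 : 0 < `|a| + 1 by rewrite ltr_wpDl.
have [t1 t10 h1] := hx _ (divr_gt0 e0 a0); exists t1 => // t /h1.
rewrite linearZ normrZ ler_pdivlMr // => h2; apply: le_trans h2.
by rewrite mulrC ler_wpM2l // lerDl.
Qed.

(** Boundedness of the semigroup carries a bound at one time over to all later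
    times. *)
Lemma vanishes_at x : (forall e, 0 < e -> exists2 t, 0 <= t & `|T t x| <= e) ->
  vanishes x.
Proof.
move=> hx e e0; have [M M0 hM] := semigroup_bound bddT.
have [t1 t10 h1] := hx _ (divr_gt0 e0 M0); exists t1 => // t tt1.
rewrite -(subrK t1 t) (semigroupD scT) ?subr_ge0 //.
apply: le_trans (hM _ _ _) _; first by rewrite subr_ge0.
by move: h1; rewrite ler_pdivlMr // mulrC.
Qed.

Lemma phi_ge0 : positive_functional phi. Proof. by case: sp. Qed.

Section OneStep.
Context (s : R) (s0 : 0 <= s) (W : {linear E -> E})
  (WE : forall x, W x = 2^-1 *: (x + T s x)).
Context (Q0 : {linear E -> E}) (c : R) (c0 : 0 <= c).
Context (Q0_ge0 : positive_operator Q0) (Q0c : op_le Q0 (T c))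
  (Q0cs : op_le Q0 (T (c + s))) (Q0h : 0 < phi (Q0 h)).

Lemma average_ge0 : positive_operator W.
Proof.
move=> x x0; rewrite WE; apply: vscale_ge0; first by rewrite invr_ge0.
by rewrite vaddr_ge0 ?posT.
Qed.

Lemma average_comm t x : 0 <= t -> W (T t x) = T t (W x).
Proof. by move=> t0; rewrite !WE [T t (_ *: _)]linearZ [T t (_ + _)]linearD (semigroupC scT _ s0 t0). Qed.

Lemma average_fixed : W h = h.
Proof. by rewrite WE Fh // half_sum. Qed.

Lemma overlap_average_le : op_le (Q0 \o W) (T (c + s)).
Proof.
move=> x x0 /=; rewrite WE linearZ linearD /=.
rewrite -[T (c + s) x]half_sum; apply: vle_scale; first by rewrite invr_ge0.
apply: vleD; first exact: Q0cs.
by rewrite semigroupD //; apply: Q0c; exact: posT.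
Qed.

(** [S] is what remains of some [T t] once a part that factors through the
    [k]-th power of [W] is split off. *)
Definition decomposition k (S : {linear E -> E}) : Prop :=
  positive_operator S /\ exists2 t, 0 <= t &
    exists2 Q : {linear E -> E}, positive_operator Q &
      forall x, T t x = Q (iter k W x) + S x.

Lemma decomposition_le k S : decomposition k S ->
  exists2 t, 0 <= t & op_le S (T t).
Proof.
move=> [S0 [t t0 [Q Q_ge0 TE]]]; exists t => // x x0.
rewrite TE vleDr //; apply: Q_ge0.
by elim: k {TE} => [//|k IH] /=; exact: average_ge0.
Qed.

Lemma decomposition_h k S : decomposition k S -> S h <=L h.
Proof.
by move=> /decomposition_le[t t0 /(_ h h0)]; rewrite Fh.
Qed.

Lemma decomposition_phi k S : decomposition k S -> forall x, 0 <=L x -> phi (S x) <= phi x.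
Proof.
move=> /decomposition_le[t t0 St] x x0; rewrite -(phiT t0 x).
by apply: functional_mono; [exact: phi_ge0 | exact: St].
Qed.

(** With [T t = Q W + S] and [T t' = Q' W + S'], the product [T t T t'] is
    [(Q T t' + S Q') W + S S']. *)
Lemma decomposition1_comp (S S' : {linear E -> E}) :
  decomposition 1 S -> decomposition 1 S' -> decomposition 1 (S \o S').
Proof.
move=> [S_ge0 [t t0 [Q Q_ge0 TE]]] [S'_ge0 [t' t'0 [Q' Q'_ge0 T'E]]].
split; first exact: positive_comp.
exists (t + t'); first exact: addr_ge0.
have [P PE] : exists P : {linear E -> E}, (P : E -> E) = fun x => Q (T t' x) + S (Q' x).
  apply: linear_exists => a x y; rewrite (linearP (T t')) (linearP Q') (linearP Q) (linearP S).
  by rewrite scalerDr addrACA.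
exists P => [x x0|x]; rewrite PE /=.
  by rewrite vaddr_ge0 // ?Q_ge0 ?S_ge0 ?Q'_ge0 //; exact: posT.
rewrite semigroupD // TE /= average_comm //.
by rewrite (T'E x) /= [S (_ + _)]linearD addrA.
Qed.

Lemma decomposition1_start b : 0 <= b ->
  exists2 S : {linear E -> E}, decomposition 1 S &
    forall x, S x = T (c + s + b) x - Q0 (W (T b x)).
Proof.
move=> b0.
have cs0 : 0 <= c + s by exact: addr_ge0.
have [S SE] : exists S : {linear E -> E},
    (S : E -> E) = fun x => T (c + s + b) x - Q0 (W (T b x)).
  apply: linear_exists => a x y.
  rewrite (linearP (T (c + s + b))) (linearP (T b)) (linearP W) (linearP Q0).
  by rewrite scalerBr opprD addrACA.
exists S => [|x]; last by rewrite SE.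
split=> [x x0|].
  rewrite SE vsubr_ge0 semigroupD //.
  by apply: (overlap_average_le (x := T b x)); exact: posT.
exists (c + s + b); first exact: addr_ge0.
have [P PE] : exists P : {linear E -> E}, (P : E -> E) = fun x => Q0 (T b x).
  by apply: linear_exists => a x y; rewrite !linearP.
exists P => [x x0|x]; rewrite PE; first by apply: Q0_ge0; exact: posT.
by rewrite SE /= -average_comm // [RHS]addrC subrK.
Qed.

(** Products of remainders are remainders, so that a minimizing sequence for
    [phi (S h)] can be made decreasing.  Its limit [l] cannot be decreased any
    more by the decompositions of the previous lemma, that is,
    [phi (Q0 (W (T b l))) = 0] for all [b]; by irreducibility, [l = 0]. *)
Lemma small_remainder e : 0 < e ->
  exists2 S : {linear E -> E}, decomposition 1 S & `|S h| <= e.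
Proof.
move=> e0; have phi0 := phi_ge0.
pose A := [set phi (S h) | S in [set S : {linear E -> E} | decomposition 1 S]].
have A_inf : has_inf A.
  split; last first.
    by exists 0 => _ [S [S_ge0 _] <-]; apply: phi0; exact: S_ge0.
  have [S dS _] := decomposition1_start (lexx 0).
  by exists (phi (S h)), S.
have inf_le S : decomposition 1 S -> inf A <= phi (S h).
  by move=> dS; apply: (ge_inf (proj2 A_inf)); exists S.
have /choice[r hr] n : exists S, decomposition 1 S /\ phi (S h) < inf A + n.+1%:R^-1.
  have [_ [S dS <-] hS] := inf_adherent (invSn_gt0 n) A_inf.
  by exists S.
(* [r n] almost minimizes, and so does the product of [r 0], ..., [r n] *)
pose F := fix F n : {linear E -> E} := if n is m.+1 then F m \o r m.+1 else r 0%N.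
have dF n : decomposition 1 (F n).
  elim: n => [|n IH] /=; first by have [] := hr 0%N.
  by apply: decomposition1_comp => //; have [] := hr n.+1.
have F_ge0 n : positive_operator (F n) by have [] := dF n.
pose d n := F n h.
have d0 n : 0 <=L d n by exact: F_ge0.
have dS n : d n.+1 <=L d n.
  apply: (positive_mono (F_ge0 n)); apply: (@decomposition_h 1).
  by have [] := hr n.+1.
have dphi n : phi (d n) < inf A + n.+1%:R^-1.
  case: n => [|n]; first by have [] := hr 0%N.
  have [dr hlt] := hr n.+1; apply: le_lt_trans hlt.
  by apply: (decomposition_phi (dF n)); have [r0 _] := dr; exact: r0.
have [l [l0 ld _ dl]] := decreasing_limit oc d0 dS.
have [w wE] : exists w : {scalar E}, (w : E -> R) = fun x => phi (Q0 (W x)).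
  by apply: scalar_exists => a x y; rewrite !linearP.
have w_ge0 : positive_functional w.
  by move=> x x0; rewrite wE; apply: phi0; apply: Q0_ge0; exact: average_ge0.
have wb : bounded_functional w.
  rewrite wE -[fun x => _]/(phi \o (Q0 \o W)); apply: bounded_functional_comp => //.
  apply: (@bounded_operator_le _ _ (T (c + s)) (Q0 \o W)).
  - exact: positive_comp average_ge0.
  - exact: overlap_average_le.
  by have [+ _ _ _] := scT; apply; exact: addr_ge0.
have wh : 0 < w h by rewrite wE average_fixed.
have wl b : 0 <= b -> w (T b l) <= 0.
  move=> b0; apply/ler_addgt0Pr => e1 e10; rewrite add0r.
  have [N hN] := invSn_lt e10.
  have [S dS' SE] := decomposition1_start b0.
  have := inf_le _ (decomposition1_comp dS' (dF N)).
  rewrite /= SE linearB phiT ?addr_ge0 // => h1.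
  have h2 := dphi N; have h3 := hN N (leqnn N).
  have : w (T b l) <= w (T b (d N)).
    by apply: (functional_mono w_ge0); apply: (positive_mono (posT b0)).
  have -> : w (T b (d N)) = phi (Q0 (W (T b (d N)))) by rewrite wE.
  move=> h4; rewrite -/(d N) in h1.
  rewrite lerBrDr in h1; have := le_lt_trans h1 h2.
  rewrite ltrD2l => h5; exact: le_trans h4 (ltW (lt_trans h5 h3)).
have l_eq0 : l = 0.
  apply/eqP; apply: contrapT => /negP ln0.
  have [|b b0] := irreducible_functional scT posT bddT irrT w_ge0 wb _ l0 ln0.
    by exists h; rewrite gt_eqF.
  by rewrite ltNge wl.
have [N hN] := dl e e0; exists (F N) => //.
by have := hN N (leqnn N); rewrite l_eq0 subr0 => /ltW.
Qed.

Lemma average_iter_linear k : exists V : {linear E -> E}, forall x, V x = iter k W x.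
Proof.
have [V VE] : exists V : {linear E -> E}, (V : E -> E) = iter k W.
  by apply: linear_exists => a x y; elim: k => [//|k IH]; rewrite !iterS IH linearP.
by exists V => x; rewrite VE.
Qed.

Lemma average_iter_ge0 k x : 0 <=L x -> 0 <=L iter k W x.
Proof. by elim: k => [//|k IH] x0; rewrite iterS average_ge0 // IH. Qed.

Lemma average_iter_comm k t x : 0 <= t -> iter k W (T t x) = T t (iter k W x).
Proof. by move=> t0; elim: k => [//|k IH]; rewrite !iterS IH average_comm. Qed.

Lemma average_iter_fixed k : iter k W h = h.
Proof. by elim: k => [//|k IH]; rewrite iterS IH average_fixed. Qed.

Lemma average_iter_ge k x : 0 <=L x -> (2^-1) ^+ k *: x <=L iter k W x.
Proof.
move=> x0; elim: k => [|k IH]; first by rewrite expr0 scale1r vlexx.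
rewrite iterS WE exprS -scalerA; apply: vle_scale; first by rewrite invr_ge0.
apply: le_vle_trans IH _; rewrite vleDl // posT //.
exact: average_iter_ge0.
Qed.

(** Multiplying [T t = Q W ^ k + S] by [T t' = Q' W + S'] gives
    [Q Q' W ^ k.+1 + (Q S' W ^ k + S T t')].  Here [Q] is bounded, since
    [W ^ k] dominates [2 ^- k] times the identity. *)
Lemma decomposition_small k e : 0 < e ->
  exists2 S : {linear E -> E}, decomposition k S & `|S h| <= e.
Proof.
elim: k e => [|k IH] e e0.
  have [Z ZE] := @zero_linear R E.
  exists Z; last by rewrite ZE normr0 ltW.
  split; first by move=> x x0; rewrite ZE vlexx.
  exists 0 => //; exists (T 0) => [|x]; first exact: posT.
  by rewrite ZE addr0.
have [S dS Sh] := IH (e / 2) (divr_gt0 e0 (ltr0n R 2)).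
have [S_ge0 [t t0 [Q Q_ge0 TE]]] := dS.
have [M M0 hM] := semigroup_bound bddT.
pose C := 2 ^+ k * M.
have C0 : 0 < C by rewrite mulr_gt0 // exprn_gt0.
have QC x : 0 <=L x -> `|Q x| <= C * `|x|.
  move=> x0; apply: (@le_trans _ _ `|2 ^+ k *: T t x|); last first.
    by rewrite normrZ ger0_norm ?exprn_ge0 // -mulrA ler_pM2l ?exprn_gt0 // hM.
  apply: norm_le; first exact: Q_ge0.
  have k0 : 0 < (2^-1 : R) ^+ k by rewrite exprn_gt0 ?invr_gt0.
  rewrite -(vle_scale2l _ _ k0) scalerA -exprMn mulVf ?pnatr_eq0 // expr1n scale1r.
  rewrite -linearZ TE; apply: (@le_vle_trans _ _ (Q (iter k W x))).
    by apply: (positive_mono Q_ge0); exact: average_iter_ge.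
  by rewrite vleDl // S_ge0.
have [S' [S'_ge0 [t' t'0 [Q' Q'_ge0 T'E]]] S'h] := small_remainder (divr_gt0 (divr_gt0 e0 (ltr0n R 2)) C0).
have [V VE] := average_iter_linear k.
have [P PE] : exists P : {linear E -> E}, (P : E -> E) = fun x => Q (S' (V x)) + S (T t' x).
  apply: linear_exists => a x y.
  rewrite (linearP V) (linearP (T t')) (linearP S') (linearP Q) (linearP S).
  by rewrite scalerDr addrACA.
exists P.
  split=> [x x0|].
    rewrite PE VE vaddr_ge0 //; last by apply: S_ge0; exact: posT.
    by apply: Q_ge0; apply: S'_ge0; exact: average_iter_ge0.
  exists (t + t'); first exact: addr_ge0.
  exists (Q \o Q' : {linear E -> E}) => [|x]; first exact: positive_comp.
  rewrite semigroupD // TE PE VE average_iter_comm // T'E /= linearD addrA.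
  by [].
rewrite PE VE average_iter_fixed Fh //; apply: le_trans (ler_normD _ _) _.
rewrite (splitr e); apply: lerD => //.
apply: le_trans (QC _ _) _; first exact: S'_ge0.
by move: S'h; rewrite ler_pdivlMr // mulrC.
Qed.

Lemma average_iter_mean k x : iter k W x = binomial_mean k (fun j => iter j (T s) x).
Proof.
elim: k x => [//|k IH] x; rewrite iterSr /= -IH.
have -> : (fun j => iter j (T s) x) \o succn = fun j => iter j (T s) (T s x).
  by apply/funext => j /=; rewrite -iterSr.
rewrite -IH; have [V VE] := average_iter_linear k.
by rewrite -!VE WE linearZ linearD.
Qed.

(** In [T t = Q W ^ k + S] with [k + 1 = m ^ 2], the first term maps [x - T s x] to
    a vector of order [1 / m], and the second one to a vector dominated by
    [2 *: S h]. *)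
Lemma difference_vanishes x : labs x <=L h -> vanishes (x - T s x).
Proof.
move=> xh; apply: vanishes_at => e e0.
have iter_h j : labs (iter j (T s) x) <=L h.
  elim: j => [//|j IH]; rewrite iterS; apply: le_vle_trans (positive_labs (posT s0) _) _.
  by rewrite -(Fh s0); apply: (positive_mono (posT s0)).
pose m := (Num.bound (`|h| / (e / 4))).+1.
have m0 : 0 < m%:R :> R by rewrite ltr0n.
have hm : 2 / m%:R * `|h| <= e / 2.
  rewrite mulrAC ler_pdivrMr //.
  have : `|h| / (e / 4) < m%:R.
    apply: lt_trans (archi_boundP _) _; last by rewrite ltr_nat.
    by rewrite divr_ge0 // divr_ge0 // ltW.
  rewrite ltr_pdivrMr ?divr_gt0 //; lra.
have [k km] : exists k, k.+1 = (m ^ 2)%N.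
  by exists (m ^ 2).-1; rewrite prednK // expn_gt0.
have [S [S_ge0 [t t0 [Q Q_ge0 TE]]] Sh] := decomposition_small k (divr_gt0 e0 (ltr0n R 4)).
exists t => //; rewrite TE.
have Qh : Q h <=L h.
  by rewrite -[X in _ <=L X](Fh t0) TE average_iter_fixed vleDl // S_ge0.
have p1 : `|Q (iter k W (x - T s x))| <= e / 2.
  apply: le_trans hm; rewrite -[2 / m%:R]ger0_norm ?divr_ge0 ?ler0n // -normrZ.
  apply: norm_labs_le; apply: le_vle_trans (positive_labs Q_ge0 _) _.
  apply: (@le_vle_trans _ _ (Q ((2 / m%:R) *: h))); last first.
    by rewrite linearZ; apply: vle_scale => //; rewrite divr_ge0.
  apply: (positive_mono Q_ge0).
  have [V VE] := average_iter_linear k.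
  rewrite -VE linearB !VE !average_iter_mean -binomial_meanB.
  have -> : (fun j => iter j (T s) x - iter j (T s) (T s x)) =
      fun j => iter j (T s) x - iter j.+1 (T s) x.
    by apply/funext => j; rewrite -iterSr.
  by apply: (binomial_mean_difference (a := fun j => iter j (T s) x) h0 _ km).
have p2 : `|S (x - T s x)| <= e / 2.
  apply: (@le_trans _ _ `|2 *: S h|); last first.
    by rewrite normrZ ger0_norm //; lra.
  apply: norm_labs_le; apply: le_vle_trans (positive_labs S_ge0 _) _.
  rewrite -linearZ; apply: (positive_mono S_ge0).
  apply: le_vle_trans (labsB _ _) _; rewrite -[2]/(1 + 1) scalerDl scale1r.
  by apply: vleD => //; exact: (iter_h 1%N).
by rewrite (splitr e); apply: le_trans (ler_normD _ _) (lerD p1 p2).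
Qed.
End OneStep.
End AsymptoticInvariance.

(** * Convergence *)

Section Convergence.
Context {R : realType} {E : banachLatticeType R} (T : R -> {linear E -> E}).
Context (oc : order_continuous_norm E)
  (scT : strongly_continuous_semigroup T) (posT : positive_semigroup T)
  (bddT : bounded_semigroup T) (irrT : irreducible_semigroup T).
Context (phi : {scalar E}) (h : E) (sp : strictly_positive phi)
  (phib : bounded_functional phi)
  (phiT : forall t, 0 <= t -> forall x, phi (T t x) = phi x)
  (Fh : Fix T h) (h0 : 0 <=L h) (phih : phi h = 1).
Implicit Types (x y z u v : E) (t s a b e r : R).

Let phi0 : positive_functional phi. Proof. by case: sp. Qed.

(** Otherwise there are [y n] in [[0, h]] with [phi (y n) <= 2 ^- n], all of
    norm at least [e]; but their tail suprema decrease to an element on which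
    [phi] vanishes. *)
Lemma norm_small_of_phi_small e : 0 < e ->
  exists2 d, 0 < d & forall y, 0 <=L y -> y <=L h -> phi y <= d -> `|y| <= e.
Proof.
move=> e0; apply: contrapT => nd.
have /choice[y hy] n : exists y, [/\ 0 <=L y, y <=L h, phi y <= 2^-1 ^+ n & e < `|y|].
  apply: contrapT => ny; apply: nd; exists (2^-1 ^+ n).
    by rewrite exprn_gt0 // invr_gt0.
  move=> y y0 yh py; rewrite leNgt; apply/negP => ey; apply: ny.
  by exists y.
have y0 n : 0 <=L y n by have [] := hy n.
have [C C0 hC] := bounded_functional_pos phib.
pose A m := [set y n | n in [set n | (m <= n)%N]].
have A0 m : A m !=set0 by exists (y m), m => /=.
have Ah m x : A m x -> x <=L h by move=> [n _ <-]; have [] := hy n.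
have /choice[g hg] m : exists w : E, is_lub (A m) w /\
    forall e, 0 < e -> exists2 a, join_closure (A m) a & `|w - a| < e.
  exact: lub_approx oc (A0 m) (@Ah m).
have gy m : y m <=L g m by have [[h1 _] _] := hg m; apply: h1; exists m => /=.
have g0 m : 0 <=L g m by exact: le_vle_trans (gy m).
have gS m : g m.+1 <=L g m.
  have [[h1 _] _] := hg m; have [[_ h2] _] := hg m.+1.
  by apply: h2 => _ [n mn <-]; apply: h1; exists n => //=; exact: ltnW.
have joins m x : join_closure (A m) x -> exists N, x <=L \sum_(i < N) y (m + i)%N.
  have mono N N' : (N <= N')%N ->
      \sum_(i < N) y (m + i)%N <=L \sum_(i < N') y (m + i)%N.
    move=> NN; rewrite -(subnKC NN) big_split_ord /= vleDl //.
    by apply: vsumr_ge0 => i _.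
  elim=> [_ [n mn <-]|x1 x2 _ [N1 h1] _ [N2 h2]].
    exists (n - m).+1; rewrite big_ord_recr /= subnKC // vleDr //.
    by apply: vsumr_ge0 => i _.
  exists (maxn N1 N2); apply: vjoin_lub.
    by apply: (le_vle_trans h1); apply: mono; exact: leq_maxl.
  by apply: (le_vle_trans h2); apply: mono; exact: leq_maxr.
have half0 n : 0 < 2^-1 ^+ n :> R by rewrite exprn_gt0 // invr_gt0.
have tail m N : phi (\sum_(i < N) y (m + i)%N) <= 2 * 2^-1 ^+ m - 2 * 2^-1 ^+ (m + N).
  elim: N => [|N IH]; first by rewrite big_ord0 linear0 addn0 subrr.
  rewrite big_ord_recr /= linearD.
  have [_ _ h3 _] := hy (m + N)%N.
  by rewrite addnS exprS mulrA mulfV ?pnatr_eq0 // mul1r; lra.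
have phig m : phi (g m) <= 2 * 2^-1 ^+ m.
  apply/ler_addgt0Pr => e1 e10; have [_ /(_ (e1 / C) (divr_gt0 e10 C0))[a ja ga]] := hg m.
  have [N aN] := joins m a ja.
  have h1 := functional_mono phi0 aN; have h2 := tail m N.
  have h3 : phi (g m - a) <= e1.
    apply: le_trans (ler_norm _) _; apply: le_trans (hC _) _.
    by move: ga; rewrite ltr_pdivlMr // mulrC => /ltW.
  rewrite linearB in h3; have := half0 (m + N)%N; lra.
have [l [l0 lg _ gl]] := decreasing_limit oc g0 gS.
have l_eq0 : l = 0.
  apply: (strictly_positive_eq0 sp) => //; apply/eqP; rewrite eq_le phi0 // andbT.
  apply/ler_addgt0Pr => e1 e10; rewrite add0r.
  have [m hm] := invSn_lt (divr_gt0 e10 (ltr0n R 2)).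
  apply: le_trans (functional_mono phi0 (lg m)) _; apply: le_trans (phig m) _.
  have := hm m (leqnn m); rewrite ltr_pdivlMr // mulrC => /ltW; apply: le_trans.
  rewrite ler_pM2l // exprVn lef_pV2 ?posrE ?exprn_gt0 //.
  by rewrite -natrX ler_nat ltn_expl.
have [m hm] := gl e e0; have := hm m (leqnn m); rewrite l_eq0 subr0 => gm.
have [_ _ _ ym] := hy m.
have := lt_le_trans ym (norm_le (y0 m) (gy m)).
by rewrite ltNge ltW.
Qed.

Context (diff0 : forall s x, 0 <= s -> labs x <=L h -> vanishes T (x - T s x)).

Lemma orbit_interval s x : 0 <= s -> labs x <=L h -> labs (T s x) <=L h.
Proof.
move=> s0 xh; apply: le_vle_trans (positive_labs (posT s0) _) _.
by rewrite -(Fh s0); exact: (positive_mono (posT s0)).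
Qed.

(** The vectors [c] of [[- h, h]] with [T t (x - c) -> 0] form a convex
    invariant set.  The energy form of [h] does not increase along orbits, so
    that a minimizing sequence converges, by the parallelogram law, to a fixed
    vector. *)
Lemma convergence_interval x : labs x <=L h -> vanishes T (x - phi x *: h).
Proof.
move=> xh; pose C := [set c | labs c <=L h /\ vanishes T (x - c)].
have [q qP] := square_exists (order_continuous_dedekind oc) h0.
pose I := dominated h; pose N := energy q phi.
have I0 : I 0 := dominated0 h.
have IP : forall (a : R) x y, I x -> I y -> I (a *: x + y) := fun a x y => @dominatedP R E h a x y.
have Nge : forall x, I x -> 0 <= N x by move=> u Iu; exact: (energy_ge0 qP phi0 Iu).
have Npar : forall x y, I x -> I y -> N (x + y) + N (x - y) = 2 * N x + 2 * N y.
  by move=> u v Iu Iv; exact: (energy_parallelogram qP phi).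
have Nbd : forall x y, I x -> I y ->
    exists K : R, forall t : R, `|t| <= 1 -> N (t *: x + y) <= K.
  by move=> u v Iu Iv; exact: (energy_bounded h0 qP phi0).
have Ih u : labs u <=L h -> I u by exists 1; rewrite ?scale1r.
have NT s u : 0 <= s -> labs u <=L h -> N (T s u) <= N u.
  move=> s0 uh; rewrite /N /energy -(phiT s0 (q u)); apply: functional_mono => //.
  apply: (square_le qP) => [|l]; first by apply: Ih; exact: orbit_interval.
  have -> : tangent h (T s u) l = T s (tangent h u l).
    by rewrite /tangent [RHS]linearB /= [T s (_ *: u)]linearZ [T s (_ *: h)]linearZ /= Fh.
  apply: (positive_mono (posT s0)); exact: (tangent_le qP l (Ih _ uh)).
have CT s c : 0 <= s -> C c -> C (T s c).
  move=> s0 [ch xc]; split; first exact: orbit_interval.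
  rewrite (_ : x - T s c = (x - c) + (c - T s c)); last by rewrite addrA subrK.
  by apply: vanishesD => //; exact: diff0.
have Cmid c c' : C c -> C c' -> C (2^-1 *: c + 2^-1 *: c').
  move=> [ch xc] [c'h xc']; split.
    apply: le_vle_trans (labsD _ _) _; rewrite !labsZ_ge0 ?invr_ge0 //.
    by rewrite -[X in _ <=L X]half_sum scalerDr vleD // vle_scale // invr_ge0.
  have -> : x - (2^-1 *: c + 2^-1 *: c') = 2^-1 *: (x - c) + 2^-1 *: (x - c').
    have xx : 2^-1 *: x + 2^-1 *: x = x by rewrite -scalerDr half_sum.
    by rewrite !scalerBr [RHS]addrACA -opprD xx.
  by apply: vanishesD; exact: vanishesZ.
have Cx : C x.
  by split => //; rewrite subrr => e e0; exists 0 => // t _; rewrite linear0 normr0 ltW.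
pose A := [set N c | c in C].
have A_inf : has_inf A.
  split; first by exists (N x), x.
  by exists 0 => _ [c [ch _] <-]; exact: Nge (Ih _ ch).
have inf_leN c : C c -> inf A <= N c.
  by move=> Cc; apply: (ge_inf (proj2 A_inf)); exists c.
have close e : 0 < e -> exists2 d, 0 < d & forall c c', C c -> C c' ->
    N c < inf A + d -> N c' < inf A + d -> `|c - c'| <= e.
  move=> e0; have [d d0 hd] := norm_small_of_phi_small (divr_gt0 e0 (ltr0n R 2)).
  exists (d ^+ 2); first by rewrite exprn_gt0.
  move=> c c' Cc Cc' Nc Nc'; have [ch _] := Cc; have [c'h _] := Cc'.
  have Ic := Ih _ ch; have Ic' := Ih _ c'h.
  pose v := 2^-1 *: c - 2^-1 *: c'.
  have vh : labs v <=L h.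
    apply: le_vle_trans (labsB _ _) _; rewrite !labsZ_ge0 ?invr_ge0 //.
    by rewrite -[X in _ <=L X]half_sum scalerDr vleD // vle_scale // invr_ge0.
  have Nv : N v <= d ^+ 2.
    have := Npar _ _ (subspaceZ I0 IP 2^-1 Ic) (subspaceZ I0 IP 2^-1 Ic').
    rewrite !(quadraticZ I0 IP Nge Npar Nbd) // -/v => par.
    have := inf_leN _ (Cmid _ _ Cc Cc').
    have e4 : (2^-1 : R) ^+ 2 = 4^-1 by rewrite exprVn -natrX.
    rewrite e4 in par; lra.
  have pv : phi (labs v) <= d.
    rewrite -ler_sqr ?nnegrE ?phi0 ?labs_ge0 ?(ltW d0) //.
    apply: le_trans (functional_sq_le h0 qP phi0 (Ih _ vh)) _.
    by rewrite phih mul1r.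
  have := hd _ (labs_ge0 v) vh pv; rewrite norm_labs.
  have -> : v = 2^-1 *: (c - c') by rewrite scalerBr.
  by rewrite normrZ ger0_norm ?invr_ge0 // mulrC ler_pdivrMr //; lra.
have /choice[c hc] n : exists c, C c /\ N c < inf A + n.+1%:R^-1.
  have [_ [c Cc <-] hN] := inf_adherent (@invSn_gt0 R n) A_inf.
  by exists c.
have tailN d : 0 < d -> exists n0, forall n, (n0 <= n)%N -> N (c n) < inf A + d.
  move=> /invSn_lt[n0 hn0]; exists n0 => n /hn0 nd.
  by have [_ hlt] := hc n; apply: (lt_trans hlt); rewrite ltrD2l.
have [l hl] : exists l, forall e, 0 < e -> exists n0, forall n, (n0 <= n)%N -> `|l - c n| < e.
  apply: cauchy_limit => e e0; have [d d0 hd] := close _ (divr_gt0 e0 (ltr0n R 2)).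
  have [n0 hn0] := tailN d d0; exists n0 => n n0n.
  apply: (@le_lt_trans _ _ (e / 2)); last by rewrite ltr_pdivrMr // ltr_pMr // ltr1n.
  have [Cn _] := hc n; have [Cn0 _] := hc n0.
  by apply: hd => //; exact: hn0.
have [M M0 hM] := semigroup_bound bddT.
have Fl : Fix T l.
  move=> s s0; apply/eqP; rewrite -subr_eq0 -normr_le0; apply/ler_addgt0Pr => e e0.
  have e3 : 0 < e / 3 by rewrite divr_gt0.
  have [d d0 hd] := close _ e3; have [n1 hn1] := tailN d d0.
  have [n2 hn2] := hl _ (divr_gt0 e3 M0); have [n3 hn3] := hl _ e3.
  pose n := maxn n1 (maxn n2 n3); have [Cn _] := hc n; have [cnh _] := Cn.
  have h1 : `|T s (c n) - c n| <= e / 3.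
    have nn : N (c n) < inf A + d by rewrite hn1 // leq_maxl.
    apply: hd => //; first exact: CT.
    by apply: le_lt_trans nn; exact: NT.
  have h2 : `|T s (l - c n)| <= e / 3.
    apply: le_trans (hM _ s0 _) _; rewrite mulrC -ler_pdivlMr //; apply: ltW.
    by apply: hn2; rewrite /n (leq_trans (leq_maxl n2 n3)) // leq_maxr.
  have h3 : `|l - c n| < e / 3.
    by apply: hn3; rewrite /n (leq_trans (leq_maxr n2 n3)) // leq_maxr.
  rewrite add0r.
  have -> : T s l - l = T s (l - c n) + (T s (c n) - c n) - (l - c n).
    by rewrite linearB addrA subrK opprB addrA subrK.
  apply: le_trans (ler_normB _ _) _.
  have := ler_normD (T s (l - c n)) (T s (c n) - c n); lra.
have lE := fixed_multiple posT bddT irrT sp phiT Fh phih Fl.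
have [K K0 hK] := bounded_functional_pos phib.
have vl : vanishes T (x - l).
  apply: vanishes_at => // e e0.
  have [n0 hn0] := hl _ (divr_gt0 (divr_gt0 e0 (ltr0n R 2)) M0).
  have [[_ vn] _] := hc n0; have [t t0 ht] := vn _ (divr_gt0 e0 (ltr0n R 2)).
  exists t => //.
  have -> : x - l = (x - c n0) - (l - c n0) by rewrite opprB addrA subrK.
  rewrite linearB (splitr e); apply: le_trans (ler_normB _ _) _.
  apply: lerD; first exact: ht.
  apply: le_trans (hM _ t0 _) _; rewrite mulrC -ler_pdivlMr //; apply: ltW.
  exact: hn0.
have phil : phi x = phi l.
  apply/eqP; rewrite -subr_eq0 -linearB -normr_le0; apply/ler_addgt0Pr => e e0.
  have [t t0 /(_ t (lexx _)) ht] := vl _ (divr_gt0 e0 K0).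
  rewrite add0r -(phiT t0); apply: le_trans (hK _) _.
  by rewrite mulrC -ler_pdivlMr.
by rewrite phil -lE.
Qed.

(** The ideal of [h] is dense and the maps [T t] are equicontinuous. *)
Lemma convergence x : vanishes T (x - phi x *: h).
Proof.
apply: vanishes_at => // e e0.
have [M M0 hM] := semigroup_bound bddT.
have [K K0 hK] := bounded_functional_pos phib.
have hn : h != 0.
  by apply/eqP => hE; have := oner_neq0 R; rewrite -phih hE linear0 eqxx.
pose D := M * (1 + K * `|h|).
have D0 : 0 < D by rewrite mulr_gt0 // ltr_pwDl // mulr_ge0 // ltW.
have [p [c c0 pc] xp] := fixed_principal_dense posT bddT irrT h0 hn Fh x
  (divr_gt0 (divr_gt0 e0 (ltr0n R 2)) D0).
have vp : vanishes T (p - phi p *: h).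
  have ph : labs (c^-1 *: p) <=L h.
    rewrite labsZ_ge0 ?invr_ge0 ?(ltW c0) // -(vle_scale2l _ _ c0) scalerA.
    by rewrite mulfV ?gt_eqF // scale1r.
  have := vanishesZ c (convergence_interval ph).
  by rewrite scalerBr scalarZ !scalerA mulrA mulfV ?gt_eqF // mul1r scale1r.
have [t t0 /(_ t (lexx _)) ht] := vp _ (divr_gt0 e0 (ltr0n R 2)).
exists t => //.
have -> : x - phi x *: h = ((x - p) - phi (x - p) *: h) + (p - phi p *: h).
  by rewrite [RHS]addrACA subrK -opprD -scalerDl -linearD subrK.
rewrite linearD (splitr e); apply: le_trans (ler_normD _ _) _.
apply: lerD => //; apply: le_trans (hM _ t0 _) _.
apply: (@le_trans _ _ (D * `|x - p|)).
  rewrite /D -mulrA ler_pM2l // mulrDl mul1r; apply: le_trans (ler_normB _ _) _.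
  rewrite lerD2l normrZ mulrAC; exact: ler_wpM2r.
by rewrite mulrC -ler_pdivlMr // ltW.
Qed.
End Convergence.

Section Assembly.
Context {R : realType} {E : banachLatticeType R} (T : R -> {linear E -> E}).
Context (scT : strongly_continuous_semigroup T) (posT : positive_semigroup T).

Lemma semigroup_iter n t x : 0 <= t -> iter n (T t) x = T (n%:R * t) x.
Proof.
move=> t0; elim: n => [|n IH]; first by rewrite mul0r (semigroup0 scT).
by rewrite iterS IH -(semigroupD scT) ?mulr_ge0 // -natr1 mulrDl mul1r addrC.
Qed.

(** Divide [s] into many small steps and telescope. *)
Lemma difference_vanishes_all (h : E) r : Fix T h -> 0 <=L h -> 0 < r ->
  (forall s, 0 < s -> s < r -> forall x, labs x <=L h -> vanishes T (x - T s x)) ->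
  forall s x, 0 <= s -> labs x <=L h -> vanishes T (x - T s x).
Proof.
move=> Fh h0 r0 small s x s0 xh.
have van0 : vanishes T 0.
  by move=> e e0; exists 0 => // t _; rewrite linear0 normr0 ltW.
move: s0; rewrite le_eqVlt => /orP[/eqP<-|s0].
  by rewrite (semigroup0 scT) subrr.
pose n := (Num.bound (s / r)).+1; have n0 : 0 < n%:R :> R by rewrite ltr0n.
pose d := s / n%:R; have d0 : 0 < d by rewrite divr_gt0.
have dr : d < r.
  rewrite ltr_pdivrMr // mulrC -ltr_pdivrMr //.
  apply: lt_trans (archi_boundP _) _; last by rewrite ltr_nat.
  by rewrite divr_ge0 // ltW.
have dmul m : forall x, labs x <=L h -> vanishes T (x - T (m%:R * d) x).
  elim: m => [|m IH] u uh; first by rewrite mul0r (semigroup0 scT) subrr.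
  have d_ge0 := ltW d0; have md_ge0 : 0 <= m%:R * d by exact: mulr_ge0.
  rewrite -natr1 mulrDl mul1r (semigroupD scT) //.
  rewrite (_ : u - _ = (u - T d u) + (T d u - T (m%:R * d) (T d u))); last first.
    by rewrite addrA subrK.
  apply: vanishesD; first exact: small.
  by apply: IH; exact: (orbit_interval posT Fh).
have sE : n%:R * d = s by rewrite /d mulrC divfK // gt_eqF.
by have := dmul n x xh; rewrite sE.
Qed.
End Assembly.

Theorem theorem4p2 (R : realType) (E : banachLatticeType R)
    (T : R -> {linear E -> E}) (t0 : R) :
  order_continuous_norm E ->
  strongly_continuous_semigroup T ->
  positive_semigroup T ->
  bounded_semigroup T ->
  irreducible_semigroup T ->
  Fix T <> [set 0] ->
  0 < t0 ->
  harris (T t0) ->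
  exists (x' : {scalar E}) (e : E),
    [/\ strictly_positive x', Fix_adjoint T x',
        quasi_interior e, Fix T e &
        forall x : E, T t x @[t --> +oo] --> x' x *: e].
Proof.
move=> oc scT posT bddT irrT Fn t0_gt0 [_ [n n_gt0 nd]].
have t0_ge0 := ltW t0_gt0.
have tn0 : 0 <= n%:R * t0 by rewrite mulr_ge0.
have nd' : ~ op_disjoint_complement finite_rank (T (n%:R * t0)).
  move: nd; rewrite (_ : iter n (T t0) = T (n%:R * t0)) //.
  by apply/funext => x; exact: semigroup_iter.
have [U [psi [y [[U0 UT] [psi0 psib] y0 Uy [u u0 Uu]]]]] :=
  not_disjoint_finite_rank oc (posT _ tn0) nd'.
have psin : exists x, psi x != 0.
  exists u; apply/eqP => pu; move/eqP: Uu; apply.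
  by apply: vle_eq; [have := Uy u u0; rewrite pu scale0r | exact: U0].
have [phi [e [sp phib phiT [Fe e0] phie]]] :=
  markov_pair scT posT bddT irrT psi0 psib psin Fn.
have Unz : exists2 x, 0 <=L x & U x != 0 by exists u.
have [c [c0 [r r0 hr]]] := overlap oc scT posT bddT irrT sp phib phiT Fe e0 phie
  tn0 U0 UT psi0 y0 Uy Unz.
have small s : 0 < s -> s < r -> forall x, labs x <=L e -> vanishes T (x - T s x).
  move=> s0 sr; have [Q [Q_ge0 Qc Qcs Qe]] := hr s s0 sr.
  have [W WE] : exists W : {linear E -> E}, (W : E -> E) = fun x => 2^-1 *: (x + T s x).
    apply: linear_exists => a x x'; rewrite (linearP (T s)) addrACA -scalerDr.
    by rewrite [LHS]scalerDr [LHS]addrC [RHS]addrC !scalerA mulrC.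
  have WE' x : W x = 2^-1 *: (x + T s x) by rewrite WE.
  by move=> x; exact: (difference_vanishes oc scT posT bddT irrT sp phib phiT Fe e0
    (ltW s0) WE' c0 Q_ge0 Qc Qcs Qe).
have diff0 := difference_vanishes_all scT posT Fe e0 r0 small.
have conv := convergence oc scT posT bddT irrT sp phib phiT Fe e0 phie diff0.
have en : e != 0.
  by apply/eqP => eE; have := oner_neq0 R; rewrite -phie eE linear0 eqxx.
exists phi, e; split=> //.
- split; first by apply/bounded_functional_continuous.
  by move=> t t_ge0; apply/funext => x; exact: phiT.
- split=> // O [x Ox] openO.
  have /nbhs_ballP[d /= d0 dO] : nbhs x O by exact: open_nbhs_nbhs.
  have [p ep xp] := fixed_principal_dense posT bddT irrT e0 en Fe x d0.
  by exists p; split=> //; apply: dO; rewrite -ball_normE.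
move=> x; apply/cvgrPdist_le => d d0; have [t1 t10 ht1] := conv x d d0.
near=> t.
have t_ge : t1 <= t by near: t; apply: nbhs_pinfty_ge; exact: num_real.
have t_ge0 : 0 <= t by exact: le_trans t_ge.
have := ht1 t t_ge; rewrite linearB linearZ /= Fe // distrC.
by [].
Unshelve. all: by end_near. Qed.
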